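(* For any integer $n \ge 3$, the number $E(n)$ of distinct non-negative integers $e$ such that $n$ does not divide $2e$ and $\rho(\mathcal{G}_{n,e}) = \rho(\mathcal{M}_{n,e})$ is $$E(n) = \begin{cases} 2P(n/2) - \frac{n}{2} - 1 & \text{if } n \text{ is even},\\[1mm] \frac{3}{4}P(n) + \frac{n - f(n) - 8 + \chi_4(n)}{4} & \text{if } n \text{ is odd}.\end{cases}$$
   Context: $P(m) = \sum_{k=1}^m \gcd(m,k)$ is Pillai's arithmetical function. $\chi_4$ is the non-principal Dirichlet character modulo 4: $\chi_4(m) = 1$ if $m \equiv 1 \pmod 4$, $\chi_4(m) = -1$ if $m \equiv 3 \pmod 4$, and $0$ otherwise. For odd $n$, $f(n) = \sum_{d \mid n} \chi_4(d)\,\phi(n/d)$, where $\phi$ is Euler's totient function. $\mathcal{M}_{n,e}$ is the set of symmetric $n\times n$ real matrices with non-negative entries (diagonal entries may be non-zero) such that all row sums are integers and the sum of all entries is $2e$; $\rho(\mathcal{M}_{n,e})$ is the minimum of the spectral radius $\rho(M)$ over $M$ in this (compact) set. $\mathcal{G}_{n,e}$ is the family of simple undirected graphs (not necessarily connected) with $n$ vertices and $e$ edges; $\rho(\mathcal{G}_{n,e})$ is the minimum over $G \in \mathcal{G}_{n,e}$ of the spectral radius of the adjacency matrix of $G$. If $\mathcal{G}_{n,e}$ is empty (i.e. $e > \binom{n}{2}$), the equality $\rho(\mathcal{G}_{n,e}) = \rho(\mathcal{M}_{n,e})$ is regarded as false. *)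

(* Defs.v *)
From HB Require Import structures.
From mathcomp Require Import all_boot all_order all_algebra.
From mathcomp Require Import finmap.
From mathcomp Require Import all_classical all_reals.
From mathcomp Require Import complex.

Set Implicit Arguments.
Unset Strict Implicit.
Unset Printing Implicit Defensive.

Import Order.TTheory GRing.Theory Num.Theory.

Local Open Scope classical_set_scope.
Local Open Scope ring_scope.

Definition pillai (m : nat) : nat := (\sum_(1 <= k < m.+1) gcdn m k)%N.

Definition chi4 (m : nat) : int :=
  if (m %% 4 == 1)%N then 1 else if (m %% 4 == 3)%N then -1 else 0.

Definition chi4_totient (n : nat) : int :=
  \sum_(d <- divisors n) chi4 d * (totient (n %/ d))%:Z.

(* The eigenvalues are taken in the complex field R[i]; [eigenvalue] is the
   library's notion, for row vectors. The supremum is a maximum when 0 < n. *)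
Definition spectral_radius (R : realType) (n : nat) (M : 'M[R]_n) : R :=
  sup [set r : R | exists2 z : R[i],
         eigenvalue (map_mx (real_complex R) M) z & `|z| = real_complex R r].

Definition calM (R : realType) (n e : nat) : set 'M[R]_n :=
  [set M | [/\ M^T = M,
               forall i j, 0 <= M i j,
               forall i, \sum_j M i j \is a Num.int
             & \sum_i \sum_j M i j = (2 * e)%:R]].
Arguments calM : clear implicits.

(* A simple graph on 'I_n is given by its set of edges, which are 2-element
   subsets of 'I_n. *)
Definition calG (n e : nat) : set {set {set 'I_n}} :=
  [set G : {set {set 'I_n}} |
     (forall a : {set 'I_n}, a \in G -> #|a| = 2%N) /\ #|G| = e].
Arguments calG : clear implicits.

(* The diagonal is zero for a simple graph, since [set i; i] is a singleton. *)
Definition adjacency (R : realType) (n : nat) (G : {set {set 'I_n}}) : 'M[R]_n :=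
  \matrix_(i, j) ([set i; j]%SET \in G)%:R.

Definition is_minimum (R : realType) (A : set R) (r : R) : Prop :=
  A r /\ lbound A r.

Definition is_rhoM (R : realType) (n e : nat) (r : R) : Prop :=
  is_minimum [set spectral_radius M | M in calM R n e] r.

Definition is_rhoG (R : realType) (n e : nat) (r : R) : Prop :=
  is_minimum [set spectral_radius (adjacency R G) | G in calG n e] r.

(* rho(G_{n,e}) = rho(M_{n,e}); false when there is no simple graph with n
   vertices and e edges, since the first minimum then does not exist. *)
Definition rho_eq (R : realType) (n e : nat) : Prop :=
  exists r : R, is_rhoG n e r /\ is_rhoM n e r.

Definition good_edges (R : realType) (n : nat) : set nat :=
  [set e | ~~ (n %| 2 * e)%N /\ rho_eq R n e].

(* Main.v *)
Require Import Defs.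
From mathcomp Require Import all_boot all_order all_algebra.
From mathcomp Require Import finmap.
From mathcomp Require Import all_classical all_reals.
From mathcomp Require Import cyclic complex polyrcf.
From mathcomp Require Import zify ring lra.

Import Order.TTheory GRing.Theory Num.Theory.
Local Open Scope ring_scope.

Set Implicit Arguments.
Unset Strict Implicit.
Unset Printing Implicit Defensive.

(** Write [2 * e = q * n + b] with [0 < b < n] and [a = n - b].  The average row
sum is not an integer, and a matrix of small spectral radius wants [a] rows of
sum [q] and [b] rows of sum [q + 1], and as much weight as possible between the
two classes.  So one class, of size [x] and row sum [s], should carry no weight
inside itself; the other has size [y] and row sum [t], with [|s - t| = 1] and
[x * s <= y * t] so that it can absorb the weight of the first.  The optimal
value [lam] is the positive root of
[x * s * (s - lam) + y * lam * (t - lam) = 0], which lies between [s] and [t].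

The lower bound ([two_degree_lower_bound]) is a Rayleigh quotient estimate.  For
row sums [d i], take the test vector [v i = d i] if [d i] is on the side of [s]
and [v i = lam] otherwise.  All the [lam - v i] have one sign, so
[v i * v j >= lam * (v i + v j) - lam ^+ 2], and the quadratic form of the matrix
exceeds [lam * \sum_i v i ^+ 2] by at least [lam * \sum_i h (d i)] for a function
[h] of the row sum.  This [h] lies above its chord through [s] and [t], and the
chord sums to zero by the equation of [lam].  Equality forces every row sum to be
[s] or [t] and [v] to be an eigenvector.  A matrix with constant blocks attains
the bound ([blowup_exists], [equitable_radius_le]).

For a graph of spectral radius [lam], the eigenvector equation says that the
vertices of degree [s] are independent and that each vertex of degree [t] has the
same number [k = x * s / y] of neighbours among them
([extremal_graph_structure]).  Hence [y] divides [x * s], [s <= y] and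
[t - k < y].  Conversely these conditions suffice: join a cyclically constructed
semiregular bipartite graph with a circulant graph on the second class
([biregular_graph_exists]).  This is [rho_eq_iff].

It remains to count the pairs [(q, b)] which satisfy these conditions and for
which [q * n + b] is even.  Each condition says that [n * q] is divisible by [b]
(or the same for [n - b], [q + 1]) together with an inequality.  With
[g = gcdn n b] the solutions are [q = j * (b / g)], [1 <= j <= g], and exchanging
[b] and [n - b] makes the inequalities of the two cases complementary
([pairs_countE]).  For even [n] the parity condition is that [b] is even, and the
sum of [gcdn n b] over even [b] is essentially [pillai n./2].  For odd [n] every
odd [j] counts once, while for even [j] there remains the sum of [gcdn n b - 1]
over odd [b < n / 2].  Expanding [gcdn n b] as the sum of [totient d] over common
divisors turns the latter into [(pillai n - chi4_totient n) / 4]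
([half_gcd_sumE]). *)

(** * Spectral radius of a symmetric non-negative matrix *)

(** Evaluate the eigenvector equation at an index where [|x_j| / v_j] is maximal:
there the triangle inequality compares [|z| * |x_j|] with [lam * |x_j|]. *)
Lemma eigenvalue_norm_le (R : realType) n (A : 'M[R[i]]_n) (v : 'I_n -> R)
    (lam : R) z :
  (forall i, 0 < v i) ->
  (forall j, \sum_i (v i)%:C%C * `|A i j| <= (lam * v j)%:C%C) ->
  eigenvalue A z -> `|z| <= lam%:C%C.
Proof.
move=> v_gt0 Av /eigenvalueP [x xA x_neq0].
have /rV0Pn [i0 xi0] := x_neq0.
pose f i : R := complex.Re `|x 0 i| / v i.
have normE i : `|x 0 i| = (f i * v i)%:C%C.
  by rewrite /f divfK ?gt_eqF// RRe_real// normr_real.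
case: (@arg_maxP _ _ _ i0 xpredT f isT) => j _ fmax.
have fj_gt0 : 0 < f j.
  apply: lt_le_trans (fmax i0 isT); rewrite -(pmulr_lgt0 _ (v_gt0 i0)).
  by rewrite -ltcR -normE normr_gt0.
have fv_gt0 : 0 < (f j * v j)%:C%C by rewrite -[0]/(0%:C%C) ltcR mulr_gt0 ?v_gt0.
rewrite -(ler_pM2r fv_gt0).
have /rowP/(_ j) := xA; rewrite !mxE => xAj.
rewrite -{1}normE -normrM -xAj.
apply: le_trans (ler_norm_sum _ _ _) _.
apply: (@le_trans _ _ ((f j)%:C%C * \sum_i (v i)%:C%C * `|A i j|)).
  rewrite mulr_sumr ler_sum// => i _; rewrite normrM mulrA ler_wpM2r//.
  by rewrite normE -rmorphM lecR; apply: ler_wpM2r (fmax i isT); rewrite ltW.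
rewrite [leRHS](_ : _ = (f j)%:C%C * (lam * v j)%:C%C).
  by rewrite ler_wpM2l// lecR ltW.
by rewrite -!rmorphM mulrCA.
Qed.

(** Without [has_sup] the supremum that defines the spectral radius would be a
meaningless default value.  The bound comes from the constant test vector. *)
Lemma spectral_radius_set (R : realType) n (M : 'M[R]_n) :
  (0 < n)%N -> has_sup [set r : R | exists2 z : R[i],
         eigenvalue (map_mx (real_complex R) M) z & `|z| = real_complex R r].
Proof.
move=> n_gt0; split.
  have [z zP] := eigenvalue_closed (map_mx (real_complex R) M) n_gt0.
  by exists (complex.Re `|z|); exists z => //; rewrite RRe_real ?normr_real.
exists (\sum_i \sum_j `|M i j|) => r [z zP zr].
rewrite -lecR -zr; apply: (eigenvalue_norm_le (v := fun=> 1)) zP => // j.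
apply: (@le_trans _ _ (\sum_i `|M i j|)%:C%C).
  rewrite rmorph_sum ler_sum// => i _; rewrite mul1r mxE.
  by rewrite normc_def /= expr0n addr0 sqrtr_sqr.
rewrite lecR mulr1 exchange_big /= [leRHS](bigD1 j)//= lerDl.
by rewrite sumr_ge0// => i _; rewrite sumr_ge0.
Qed.

(** Collatz-Wielandt upper bound: a positive vector that [M] stretches by at most
[lam] certifies that the spectral radius is at most [lam]. *)
Lemma spectral_radius_le (R : realType) n (M : 'M[R]_n) (v : 'I_n -> R)
    (lam : R) :
  (0 < n)%N -> (forall i j, 0 <= M i j) -> (forall i, 0 < v i) ->
  (forall j, \sum_i v i * M i j <= lam * v j) ->
  spectral_radius M <= lam.
Proof.
move=> n_gt0 M_ge0 v_gt0 Mv; apply: ge_sup.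
  by have [] := spectral_radius_set M n_gt0.
move=> r [z zP zr]; rewrite -lecR -zr; apply: (eigenvalue_norm_le v_gt0 _ zP) => j.
rewrite (le_trans _ (_ : (\sum_i v i * M i j)%:C%C <= _)) ?lecR//.
rewrite rmorph_sum ler_sum// => i _; rewrite rmorphM; apply: ler_wpM2l.
  by rewrite lecR ltW.
by rewrite mxE normc_def /= expr0n addr0 sqrtr_sqr ger0_norm.
Qed.

Lemma eigenvalue_le_spectral_radius (R : realType) n (M : 'M[R]_n) z :
  (0 < n)%N -> eigenvalue (map_mx (real_complex R) M) z ->
  `|z| <= (spectral_radius M)%:C%C.
Proof.
move=> n_gt0 zP; rewrite -(RRe_real (normr_real z)) lecR.
have /ubP := sup_upper_bound (spectral_radius_set M n_gt0); apply.
by exists z => //; rewrite RRe_real ?normr_real.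
Qed.

Lemma hermitian_diagonalization (C : numClosedFieldType) n (A : 'M[C]_n) :
  A \is hermsymmx ->
  exists P : 'M[C]_n, exists D : 'rV[C]_n,
  [/\ P *m (P^T ^ Num.conj_op)%sesqui = 1%:M, P *m A = diag_mx D *m P
    & D \is a mxOver Num.real].
Proof.
move=> A_herm; exists (spectralmx A), (spectral_diag A); split.
- by apply/unitarymxP; exact: spectral_unitarymx.
- have /orthomx_spectralP {2}-> := hermitian_normalmx A_herm.
  by rewrite !mulmxA mulmxV ?spectral_unit// mul1mx.
exact: hermitian_spectral_diag_real.
Qed.

Lemma symmetric_diagonalization (R : realType) n (M : 'M[R]_n) :
  (0 < n)%N -> M^T = M ->
  exists P : 'M[R[i]]_n, exists D : 'I_n -> R[i],
  [/\ P *m (P^T ^ Num.conj_op)%sesqui = 1%:M,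
      P *m map_mx (real_complex R) M = diag_mx (\row_k D k) *m P
    & forall k, D k <= (spectral_radius M)%:C%C].
Proof.
move=> n_gt0 Msym.
have /hermitian_diagonalization [P [D [PP PA /mxOverP D_real]]] :
    map_mx (real_complex R) M \is hermsymmx.
  apply: realsym_hermsym.
    by apply/is_hermitianmxP; rewrite scale1r map_mx_id// map_trmx Msym.
  by apply/mxOverP => i j; rewrite mxE; apply/complex_realP; exists (M i j).
exists P, (D 0); split=> //.
  by rewrite PA; congr (diag_mx _ *m _); apply/rowP => k; rewrite mxE.
move=> k; apply: le_trans (real_ler_norm (D_real 0 k)) _.
apply: eigenvalue_le_spectral_radius n_gt0 _; apply/eigenvalueP.
exists (row k P).
  by rewrite -row_mul PA; apply/rowP => j; rewrite mul_diag_mx !mxE.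
apply/eqP => Pk0; have /matrixP/(_ k k)/eqP := PP.
have /rowP P0 := Pk0; rewrite !mxE eqxx big1 ?(eq_sym 0) ?oner_eq0// => j _.
by have := P0 j; rewrite !mxE => ->; rewrite mul0r.
Qed.

(** In coordinates [w] along an orthonormal eigenbasis with eigenvalues [D k], the
difference of the two sides is the sum of the terms [(rho - D k) * |w_k|^2], all
non-negative.  If it vanishes, [w] lives on the eigenvalue [rho]. *)
Lemma rayleigh (R : realType) n (M : 'M[R]_n) (v : 'I_n -> R) :
  (0 < n)%N -> M^T = M ->
  \sum_i \sum_j M i j * (v i * v j) <= spectral_radius M * \sum_i v i ^+ 2 /\
  (\sum_i \sum_j M i j * (v i * v j) = spectral_radius M * \sum_i v i ^+ 2 ->
   forall j, \sum_i v i * M i j = spectral_radius M * v j).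
Proof.
move=> n_gt0 Msym.
have [P [D [PP PA Dle]]] := symmetric_diagonalization n_gt0 Msym.
pose x : 'rV[R[i]]_n := \row_i (v i)%:C%C.
have xT : (x^T ^ Num.conj_op)%sesqui = x^T.
  apply/colP => i; rewrite !mxE conj_Creal//.
  by apply/complex_realP; exists (v i).
have [w [xE xTE]] : exists w : 'rV_n, x = w *m P /\
    x^T = (P^T ^ Num.conj_op)%sesqui *m (w^T ^ Num.conj_op)%sesqui.
  exists (x *m (P^T ^ Num.conj_op)%sesqui).
  have xE : x = x *m (P^T ^ Num.conj_op)%sesqui *m P.
    by rewrite -mulmxA (mulmx1C PP) mulmx1.
  by split=> //; rewrite -[LHS]xT {1}xE trmx_mul map_mxM.
have sumE : (\sum_i v i ^+ 2)%:C%C = \sum_k `|w 0 k| ^+ 2.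
  transitivity ((x *m x^T) 0 0).
    by rewrite mxE rmorph_sum; apply: eq_bigr => i _; rewrite !mxE rmorphXn.
  rewrite {1}xE xTE mulmxA -(mulmxA w) PP mulmx1 mxE; apply: eq_bigr => k _.
  by rewrite !mxE normCK.
have quadE : (\sum_i \sum_j M i j * (v i * v j))%:C%C = \sum_k D k * `|w 0 k| ^+ 2.
  transitivity ((x *m map_mx (real_complex R) M *m x^T) 0 0).
    rewrite mxE exchange_big rmorph_sum; apply: eq_bigr => j _ /=.
    rewrite !mxE rmorph_sum mulr_suml; apply: eq_bigr => i _.
    by rewrite !mxE -!rmorphM; congr (_ %:C%C); ring.
  rewrite {1}xE -(mulmxA w) PA xTE mulmxA -!mulmxA (mulmxA P) PP mul1mx mulmxA mxE.
  apply: eq_bigr => k _.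
  by rewrite mul_mx_diag !mxE normCK; ring.
set rho := spectral_radius M in Dle *.
have term_ge0 k : 0 <= (rho%:C%C - D k) * `|w 0 k| ^+ 2.
  by rewrite mulr_ge0 ?subr_ge0 ?exprn_ge0.
have gapE : (rho * (\sum_i v i ^+ 2) - \sum_i \sum_j M i j * (v i * v j))%:C%C =
    \sum_k (rho%:C%C - D k) * `|w 0 k| ^+ 2.
  rewrite rmorphB rmorphM /= sumE quadE mulr_sumr -sumrB.
  by apply: eq_bigr => k _; rewrite mulrBl.
split; first by rewrite -subr_ge0 -lecR gapE sumr_ge0.
move=> eq_quad j; move: gapE; rewrite eq_quad subrr => /esym/eqP.
rewrite psumr_eq0// => /allP term0.
have wD : w *m diag_mx (\row_k D k) = rho%:C%C *: w.
  apply/rowP => k; rewrite mul_mx_diag !mxE mulrC; apply/eqP.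
  rewrite eq_sym -subr_eq0 -mulrBl mulf_eq0.
  have := term0 k (mem_index_enum k).
  by rewrite /= mulf_eq0 expf_eq0 normr_eq0.
have : x *m map_mx (real_complex R) M = rho%:C%C *: x.
  by rewrite {1}xE -mulmxA PA mulmxA wD -scalemxAl -xE.
move/rowP/(_ j); rewrite !mxE -rmorphM => xM; apply: complexI.
by rewrite -xM rmorph_sum; apply: eq_bigr => i _; rewrite !mxE rmorphM.
Qed.

(** * A convexity lower bound on the spectral radius *)

(** The position of the optimal value: strict at [s], weak at [t], because
[lam = t] occurs when [s = 0]. *)
Definition between (R : realType) (s t : nat) (lam : R) :=
  (t = s.+1 /\ s%:R < lam <= t%:R) \/ (s = t.+1 /\ t%:R <= lam < s%:R).

Definition s_side (s t d : nat) := if (s < t)%N then (d <= s)%N else (s <= d)%N.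

(** The test vector copies the row sum on the side of [s] and is capped at [lam] on
the side of [t], so that [lam - v] keeps one sign. *)
Definition test_weight (R : realType) (lam : R) (s t d : nat) : R :=
  if s_side s t d then d%:R else lam.

Lemma test_weight_same_side (R : realType) (lam : R) s t d d' :
  between s t lam ->
  0 <= (lam - test_weight lam s t d) * (lam - test_weight lam s t d').
Proof.
rewrite /test_weight /s_side => -[[-> /andP[s_lt _]]|[-> /andP[_ s_lt]]].
  rewrite ltnSn; case: (leqP d s) => [d_le|_] /=; last by rewrite subrr mul0r.
  case: (leqP d' s) => [d'_le|_] /=; last by rewrite subrr mulr0.
  by rewrite mulr_ge0// subr_ge0 (le_trans _ (ltW s_lt))// ler_nat.
have -> : (t.+1 < t)%N = false by lia.
case: (leqP t.+1 d) => [d_le|_] /=; last by rewrite subrr mul0r.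
case: (leqP t.+1 d') => [d'_le|_] /=; last by rewrite subrr mulr0.
by rewrite mulr_le0// subr_le0 (le_trans (ltW s_lt))// ler_nat.
Qed.

(** The product [(lam - v i) * (lam - v j) >= 0] bounds [v i * v j] below by an
affine function of [v i] and [v j], whose sum against [M] needs row sums only. *)
Lemma quad_form_ge (R : realType) n (M : 'M[R]_n) (d v : 'I_n -> R) (lam : R) :
  M^T = M -> (forall i j, 0 <= M i j) -> (forall i, \sum_j M i j = d i) ->
  (forall i j, 0 <= (lam - v i) * (lam - v j)) ->
  lam * \sum_i (2 * d i * v i - lam * d i) <= \sum_i \sum_j M i j * (v i * v j).
Proof.
move=> Msym M_ge0 Md v_side.
have <- : \sum_i \sum_j M i j * (lam * (v i + v j) - lam ^+ 2) =
    lam * \sum_i (2 * d i * v i - lam * d i).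
  have sum1 : \sum_i \sum_j M i j * v i = \sum_i d i * v i.
    by apply: eq_bigr => i _; rewrite -mulr_suml Md.
  have sum2 : \sum_i \sum_j M i j * v j = \sum_i d i * v i.
    rewrite exchange_big; apply: eq_bigr => i _ /=; rewrite -mulr_suml -Md.
    by congr (_ * _); apply: eq_bigr => j _; rewrite -[in LHS]Msym mxE.
  transitivity (lam * (\sum_i \sum_j M i j * v i + \sum_i \sum_j M i j * v j
     - lam * \sum_i \sum_j M i j)).
    rewrite -big_split /= mulr_sumr -sumrB mulr_sumr; apply: eq_bigr => i _ /=.
    rewrite -big_split /= mulr_sumr -sumrB mulr_sumr; apply: eq_bigr => j _ /=.
    by ring.
  rewrite sum1 sum2 -big_split /= mulr_sumr -sumrB; congr (_ * _).
  by apply: eq_bigr => i _ /=; rewrite Md; ring.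
apply: ler_sum => i _; apply: ler_sum => j _; apply: ler_wpM2l => //.
by rewrite -subr_ge0 (le_trans (v_side i j))// le_eqVlt; apply/orP; left; apply/eqP; ring.
Qed.

(** Here [h] is the contribution of a row of sum [d] to the lower bound and [l] is
the chord of [h] through [s] and [t].  For an integer [d] at distance [u] beyond
[s] or beyond [t], the excess [h - l] is [u] times a positive number.  Both signs
of [t - s] are covered since [(t - s) ^+ 2 = 1]. *)
Lemma chord_bound (R : realType) (lam : R) s t d :
  between s t lam ->
  let h := 2 * d%:R * test_weight lam s t d - lam * d%:R - test_weight lam s t d ^+ 2 in
  let l := s%:R * (s%:R - lam) +
    (d%:R - s%:R) * (t%:R - s%:R) * (lam * (t%:R - lam) - s%:R * (s%:R - lam)) in
  l <= h /\ (h = l -> d = s \/ d = t).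
Proof.
move=> st h l.
suff [u [c [c_gt0 hl u0]]] : exists (u : nat) (c : R),
    [/\ 0 < c, h - l = u%:R * c & u = 0%N -> d = s \/ d = t].
  split; first by rewrite -subr_ge0 hl mulr_ge0// ltW.
  move=> /eqP; rewrite -subr_eq0 hl mulf_eq0 (gt_eqF c_gt0) orbF pnatr_eq0.
  by move/eqP.
rewrite /h /l /test_weight /s_side => {h l}.
case: st => -[-> /andP[lam1 lam2]].
  rewrite ltnSn; have [d_le|d_gt] := leqP d s.
    exists (s - d)%N, ((s - d)%:R + (lam - s%:R) * (2 - (lam - s%:R))).
    split; [|by rewrite natrB//; ring|by lia].
    rewrite ltr_wpDl// mulr_gt0//; first by rewrite subr_gt0.
    move: lam2; rewrite -natr1 => lam2; lra.
  exists (d - s.+1)%N, ((lam - s%:R) ^+ 2).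
  split; [|by rewrite natrB// -natr1; ring|by lia].
  by rewrite exprn_gt0// subr_gt0.
have -> : (t.+1 < t)%N = false by lia.
have [d_ge|d_lt] := leqP t.+1 d.
  exists (d - t.+1)%N, ((d - t.+1)%:R + (t.+1%:R - lam) * (2 - (t.+1%:R - lam))).
  split; [|by rewrite natrB// -natr1; ring|by lia].
  rewrite ltr_wpDl// mulr_gt0//; first by rewrite subr_gt0.
  rewrite -natr1; lra.
exists (t - d)%N, ((t.+1%:R - lam) ^+ 2).
split; [|by rewrite natrB// -natr1; ring|by lia].
by rewrite exprn_gt0// subr_gt0.
Qed.

(** The chords [l i] sum to zero: this is exactly the equation of [lam], so the
contributions [h i] have a non-negative sum and the Rayleigh quotient of the test
vector is at least [lam].  When the spectral radius is [lam], all these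
inequalities are equalities. *)
Lemma two_degree_lower_bound (R : realType) n (M : 'M[R]_n) (d : 'I_n -> nat)
    (lam : R) (x s y t : nat) :
  (0 < n)%N -> M^T = M -> (forall i j, 0 <= M i j) ->
  (forall i, \sum_j M i j = (d i)%:R) ->
  (x + y)%N = n -> (\sum_i d i)%N = (x * s + y * t)%N -> (0 < y * t)%N ->
  0 < lam -> between s t lam ->
  x%:R * (s%:R * (s%:R - lam)) + y%:R * (lam * (t%:R - lam)) = 0 ->
  lam <= spectral_radius M /\
  (spectral_radius M = lam -> (forall i, d i = s \/ d i = t) /\
    forall j, \sum_i test_weight lam s t (d i) * M i j = lam * test_weight lam s t (d j)).
Proof.
move=> n_gt0 Msym M_ge0 Md xy d_sum yt_gt0 lam_gt0 st lamE.
pose v i := test_weight lam s t (d i).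
have [rle req] := rayleigh v n_gt0 Msym.
have qge := quad_form_ge Msym M_ge0 Md (fun i j => test_weight_same_side (d i) (d j) st).
rewrite -/v in qge.
pose h i := 2 * (d i)%:R * v i - lam * (d i)%:R - v i ^+ 2.
pose l i := s%:R * (s%:R - lam) + ((d i)%:R - s%:R) * (t%:R - s%:R) *
  (lam * (t%:R - lam) - s%:R * (s%:R - lam)).
have hl i : l i <= h i /\ (h i = l i -> d i = s \/ d i = t) by exact: chord_bound.
have l_sum : \sum_i l i = 0.
  have sumc (c : R) : \sum_(i < n) c = n%:R * c.
    by rewrite sumr_const card_ord mulr_natl.
  rewrite big_split /= -!mulr_suml sumrB !sumc -natr_sum d_sum -lamE natrD !natrM.
  have -> : n%:R = x%:R + y%:R :> R by rewrite -natrD xy.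
  by case: st => -[-> _]; rewrite -natr1; ring.
have h_sum_ge0 : 0 <= \sum_i h i.
  by rewrite -[leLHS]l_sum ler_sum// => i _; have [] := hl i.
have v2E : \sum_i (2 * (d i)%:R * v i - lam * (d i)%:R) =
    \sum_i h i + \sum_i v i ^+ 2.
  by rewrite -big_split; apply: eq_bigr => i _ /=; rewrite /h; ring.
have v_gt0 : 0 < \sum_i v i ^+ 2.
  rewrite lt0r sumr_ge0 ?andbT => [|i _]; last exact: sqr_ge0.
  apply/negP; rewrite psumr_eq0 => [/allP v0|i _]; last exact: sqr_ge0.
  have d0 i : d i = 0%N.
    have := v0 i (mem_index_enum i); rewrite /= sqrf_eq0 /v /test_weight.
    by case: ifP => _; rewrite ?pnatr_eq0 ?(gt_eqF lam_gt0)// => /eqP.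
  by move: d_sum; rewrite big1 //; lia.
move: qge; rewrite v2E mulrDr -/v => qge.
have gap : lam * \sum_i h i <= (spectral_radius M - lam) * \sum_i v i ^+ 2.
  by rewrite mulrBl lerBrDr (le_trans qge rle).
split.
  by rewrite -subr_ge0 -(pmulr_lge0 _ v_gt0) (le_trans _ gap)// mulr_ge0// ltW.
move=> rho_lam; move: gap qge rle req; rewrite rho_lam subrr mul0r.
rewrite pmulr_rle0// => h_sum_le0.
have h_sum : \sum_i h i = 0 by apply/eqP; rewrite eq_le h_sum_le0.
rewrite h_sum mulr0 add0r => qge rle req.
split; last by move=> j; apply: req; apply/eqP; rewrite eq_le rle.
move=> i; apply: (hl i).2; apply/eqP; rewrite -subr_eq0.
have /eqP : \sum_i (h i - l i) = 0 by rewrite sumrB h_sum l_sum subrr.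
rewrite psumr_eq0 => [/allP/(_ i (mem_index_enum i))//|j _].
by rewrite subr_ge0; have [] := hl j.
Qed.

(** The polynomial takes opposite signs at [s] and [t] when [s] is positive.  When
[s = 0] the condition on [x] and [y] leaves only [t = 1], and [lam = 1] is a
root. *)
Lemma two_degree_root (R : realType) (x s y t : nat) :
  (x * s <= y * t)%N -> (0 < x)%N -> (0 < y * t)%N -> t = s.+1 \/ s = t.+1 ->
  exists lam : R, [/\ 0 < lam, between s t lam &
    x%:R * (s%:R * (s%:R - lam)) + y%:R * (lam * (t%:R - lam)) = 0].
Proof.
move=> xs_le x_gt0; rewrite muln_gt0 => /andP[y_gt0 t_gt0] st.
have [s0|s_neq0] := eqVneq s 0%N.
  have t1 : t = 1%N by lia.
  exists 1; rewrite s0 t1 mul0r subrr !mulr0 addr0; split=> //.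
  by left; rewrite ltr01 lexx.
have s_gt0 : (0 < s%:R :> R) by rewrite ltr0n lt0n.
have tR_gt0 : (0 < t%:R :> R) by rewrite ltr0n.
pose p : {poly R} := (x%:R * s%:R)%:P * (s%:R%:P - 'X) + y%:R%:P * ('X * (t%:R%:P - 'X)).
have pE z : p.[z] = x%:R * (s%:R * (s%:R - z)) + y%:R * (z * (t%:R - z)).
  by rewrite /p !(hornerD, hornerM, hornerN, hornerC, hornerX); ring.
have ps : p.[s%:R] = y%:R * s%:R * (t%:R - s%:R) by rewrite pE; ring.
have pt : p.[t%:R] = - (x%:R * s%:R * (t%:R - s%:R)) by rewrite pE; ring.
have lt01 (a : nat) : a%:R < a.+1%:R :> R by rewrite ltr_nat.
have xy_gt0 : 0 < x%:R * s%:R * (y%:R * s%:R) :> R.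
  by rewrite -!natrM ltr0n !muln_gt0 x_gt0 y_gt0 lt0n s_neq0.
have p_st : p.[s%:R] * p.[t%:R] < 0.
  rewrite ps pt; rewrite -oppr_gt0.
  rewrite [ltRHS](_ : _ = x%:R * s%:R * (y%:R * s%:R) * (t%:R - s%:R) ^+ 2); last by ring.
  rewrite mulr_gt0// exprn_even_gt0//= subr_eq0 eqr_nat; lia.
case: st => st.
  have [|lam /itvP lam_st /eqP] := @poly_ivtoo _ p s%:R t%:R _ p_st.
    by rewrite ler_nat st.
  rewrite pE => lamE; exists lam; split=> //.
    by rewrite (lt_trans s_gt0)// lam_st.
  by left; rewrite !lam_st.
have [||lam /itvP lam_st /eqP] := @poly_ivtoo _ p t%:R s%:R.
- by rewrite ler_nat st.
- by rewrite mulrC.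
rewrite pE => lamE; exists lam; split=> //.
  by rewrite (lt_trans tR_gt0)// lam_st.
by right; rewrite !lam_st.
Qed.

(** * Matrices attaining the bound *)

Lemma sum_ord_low (V : nmodType) x y (F : nat -> V) :
  \sum_(i < x + y | (i < x)%N) F i = \sum_(0 <= i < x) F i.
Proof.
rewrite big_split_ord /= [X in _ + X]big1 ?addr0 => [|i]; last by rewrite ltnNge leq_addr.
by rewrite big_mkord; apply: eq_bigl => i; rewrite ltn_ord.
Qed.

Lemma sum_ord_high (V : nmodType) x y (F : nat -> V) :
  \sum_(i < x + y | ~~ (i < x)%N) F i = \sum_(0 <= i < y) F (x + i)%N.
Proof.
rewrite big_split_ord /= big1 ?add0r => [|i]; last by rewrite ltn_ord.
by rewrite big_mkord; apply: eq_bigl => i; rewrite ltnNge leq_addr.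
Qed.

(** The indices below [x] carry no weight among themselves, and each of the other
indices sends weight [k] to them. *)
Definition equitable (R : realType) x y (M : 'M[R]_(x + y)) (s t : nat) (k : R) :=
  (forall j : 'I_(x + y), (j < x)%N ->
     \sum_(i < x + y | (i < x)%N) M i j = 0 /\
     \sum_(i < x + y | ~~ (i < x)%N) M i j = s%:R) /\
  (forall j : 'I_(x + y), ~~ (j < x)%N ->
     \sum_(i < x + y | (i < x)%N) M i j = k /\
     \sum_(i < x + y | ~~ (i < x)%N) M i j = t%:R - k).

Lemma equitable_calM (R : realType) x s y t e (M : 'M[R]_(x + y)) k :
  M^T = M -> (forall i j, 0 <= M i j) -> equitable M s t k ->
  (x * s + y * t = 2 * e)%N -> calM R (x + y) e M.
Proof.
move=> Msym M_ge0 [M_low M_high] e2.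
have Mcol (j : 'I_(x + y)) : \sum_i M i j = (if (j < x)%N then s else t)%:R.
  rewrite (bigID (fun i : 'I_(x + y) => (i < x)%N)) /=.
  case: ifPn => [/M_low|/M_high] [-> ->].
    by rewrite add0r.
  by rewrite addrC subrK.
have Mrow i : \sum_j M i j = (if (i < x)%N then s else t)%:R.
  by rewrite -Mcol; apply: eq_bigr => j _; rewrite -[in LHS]Msym mxE.
split=> // [i|]; first by rewrite Mrow intr_nat.
rewrite (eq_bigr _ (fun i _ => Mrow i)) (bigID (fun i : 'I_(x + y) => (i < x)%N)) /=.
rewrite (sum_ord_low _ _ (fun i => (if (i < x)%N then s else t)%:R)).
rewrite (sum_ord_high _ _ (fun i => (if (i < x)%N then s else t)%:R)).
rewrite (eq_big_nat _ _ (F2 := fun=> s%:R)) => [|i /andP[_ ->]//].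
rewrite [X in _ + X](eq_bigr (fun=> t%:R)) => [|i _]; last by rewrite ltnNge leq_addr.
by rewrite !sumr_const_nat !subn0 -!mulrnA -natrD -e2 !(mulnC s, mulnC t).
Qed.

(** The vector with value [s] below [x] and [lam] elsewhere is an eigenvector for
[lam].  It is positive unless [s = 0]; then [lam = t = 1] and the constant vector
serves instead. *)
Lemma equitable_radius_le (R : realType) x s y t (M : 'M[R]_(x + y)) k (lam : R) :
  (forall i j, 0 <= M i j) -> equitable M s t k -> (0 < y * t)%N ->
  y%:R * k = x%:R * s%:R -> 0 < lam -> between s t lam ->
  x%:R * (s%:R * (s%:R - lam)) + y%:R * (lam * (t%:R - lam)) = 0 ->
  spectral_radius M <= lam.
Proof.
move=> M_ge0 [M_low M_high]; rewrite muln_gt0 => /andP[y_gt0 t_gt0].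
move=> ykE lam_gt0 st lamE.
have n_gt0 : (0 < x + y)%N by lia.
have y_neq0 : y%:R != 0 :> R by rewrite pnatr_eq0; lia.
have split_sum (v w : R) (j : 'I_(x + y)) :
    \sum_(i < x + y) (if (i < x)%N then v else w) * M i j =
    v * \sum_(i < x + y | (i < x)%N) M i j + w * \sum_(i < x + y | ~~ (i < x)%N) M i j.
  rewrite (bigID (fun i : 'I_(x + y) => (i < x)%N)) /= !mulr_sumr.
  by congr (_ + _); apply: eq_bigr => i; [move=> ->|move/negPf=> ->].
have kE : lam * (t%:R - lam) = k * (lam - s%:R).
  by apply: (mulfI y_neq0); rewrite [RHS]mulrA ykE; move: lamE; lra.
have [s0|s_gt0] := posnP s.
  have lam1 : lam = 1.
    have t1 : t = 1%N by case: st => -[]; lia.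
    have k0 : k = 0 by apply: (mulfI y_neq0); rewrite ykE s0 !mulr0.
    move: kE; rewrite k0 mul0r => /eqP; rewrite mulf_eq0 (gt_eqF lam_gt0) /=.
    by rewrite t1 subr_eq0 eq_sym => /eqP.
  apply: (@spectral_radius_le _ _ _ (fun=> 1)) => // j.
  have := split_sum 1 1 j; under eq_bigr do rewrite if_same; move=> ->.
  rewrite !mul1r lam1 mul1r; case: (boolP (j < x)%N) => [/M_low|/M_high] [-> ->].
    by rewrite s0 add0r ler01.
  by rewrite addrC subrK; case: st => -[]; [move->; rewrite s0|rewrite s0].
pose v (i : 'I_(x + y)) : R := if (i < x)%N then s%:R else lam.
apply: (spectral_radius_le (v := v)) => //.
  by move=> i; rewrite /v; case: ifP => // _; rewrite ltr0n.
move=> j; rewrite split_sum /v; case: ifPn => [/M_low|/M_high] [-> ->].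
  by rewrite mulr0 add0r.
by rewrite le_eqVlt; apply/orP; left; apply/eqP; move: kE; lra.
Qed.

Lemma sum_low_const (R : pzRingType) x y (c : R) :
  \sum_(i < x + y | (i < x)%N) c = x%:R * c.
Proof. by rewrite (sum_ord_low x y (fun=> c)) sumr_const_nat subn0 mulr_natl. Qed.

Lemma sum_high_const (R : pzRingType) x y (c : R) :
  \sum_(i < x + y | ~~ (i < x)%N) c = y%:R * c.
Proof. by rewrite (sum_ord_high x y (fun=> c)) sumr_const_nat subn0 mulr_natl. Qed.

(** Spread the weight evenly over each block; the entries of the last block are
non-negative because [x * s <= y * t]. *)
Lemma blowup_exists (R : realType) (x s y t e : nat) :
  (x * s <= y * t)%N -> (0 < y)%N -> (x * s + y * t = 2 * e)%N ->
  exists M : 'M[R]_(x + y), exists k : R,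
    [/\ calM R (x + y) e M, equitable M s t k & y%:R * k = x%:R * s%:R].
Proof.
move=> xs_le y_gt0 e2; have y_neq0 : y%:R != 0 :> R by rewrite pnatr_eq0 -lt0n.
pose k : R := x%:R * s%:R / y%:R.
pose f (i j : nat) : R := if (i < x)%N then if (j < x)%N then 0 else s%:R / y%:R
  else if (j < x)%N then s%:R / y%:R else (t%:R - k) / y%:R.
pose M : 'M[R]_(x + y) := \matrix_(i, j) f i j.
have M_ge0 i j : 0 <= M i j.
  rewrite mxE /f; case: ifP => _; case: ifP => _; rewrite ?divr_ge0//.
  by rewrite subr_ge0 ler_pdivrMr ?ltr0n// -!natrM ler_nat (mulnC t).
have M_eq : equitable M s t k.
  split=> j jx; split.
  - by rewrite big1// => i ix; rewrite mxE /f ix jx.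
  - rewrite (eq_bigr (fun=> s%:R / y%:R)) => [|i /negPf ix]; last by rewrite mxE /f ix jx.
    by rewrite sum_high_const mulrC divfK.
  - rewrite (eq_bigr (fun=> s%:R / y%:R)) => [|i ix]; last by rewrite mxE /f ix (negPf jx).
    by rewrite sum_low_const mulrA.
  rewrite (eq_bigr (fun=> (t%:R - k) / y%:R)) => [|i /negPf ix]; last first.
    by rewrite mxE /f ix (negPf jx).
  by rewrite sum_high_const mulrC divfK.
exists M, k; split=> //; last by rewrite mulrC divfK.
apply: equitable_calM M_eq e2 => //.
by apply/matrixP => i j; rewrite !mxE /f; case: ifP => // _; case: ifP.
Qed.

(** * Adjacency matrices *)

Section Adjacency.
Variables (R : realType) (n : nat).

Lemma adjacency_sym (G : {set {set 'I_n}}) : (adjacency R G)^T = adjacency R G.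
Proof. by apply/matrixP => i j; rewrite !mxE finset.setUC. Qed.

(** Each edge is hit by the two orderings of its end points. *)
Lemma edge_ends (a : {set 'I_n}) : #|a| = 2%N ->
  (\sum_i \sum_j ([set i; j]%SET == a) = 2)%N.
Proof.
move=> a2; have /cards2P [u [v [uv ->]]] : #|a| == 2%N by rewrite a2.
have pairE i j : ([set i; j]%SET == [set u; v]%SET) =
    ((i == u) && (j == v)) || ((i == v) && (j == u)).
  apply/eqP/idP => [E|/orP[]/andP[/eqP-> /eqP->]//]; last exact: finset.setUC.
  have : u \in [set i; j]%SET by rewrite E !inE eqxx.
  have : v \in [set i; j]%SET by rewrite E !inE eqxx orbT.
  rewrite !inE => /orP[]/eqP vE /orP[]/eqP uE; subst; rewrite ?eqxx ?orbT//.
  - by rewrite eqxx in uv.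
  - by rewrite eqxx in uv.
rewrite pair_bigA /= (eq_bigr (fun p => ((p \in [set (u, v); (v, u)]%SET : nat)))).
  rewrite -big_mkcond sum1_card cards2.
  by rewrite xpair_eqE (negPf uv).
by move=> [i j] _; rewrite pairE !inE !xpair_eqE.
Qed.

Lemma degree_sum (G : {set {set 'I_n}}) : (forall a, a \in G -> #|a| = 2%N) ->
  (\sum_i \sum_j ([set i; j]%SET \in G) = 2 * #|G|)%N.
Proof.
move=> G2; transitivity (\sum_(a in G) \sum_i \sum_j ([set i; j]%SET == a))%N.
  rewrite [RHS]exchange_big; apply: eq_bigr => i _ /=; rewrite [RHS]exchange_big.
  apply: eq_bigr => j _ /=; case: (boolP (_ \in G)) => [ijG|ijG].
    rewrite (bigD1 _ ijG)/= eqxx big1// => a /andP[_ /negPf].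
    by rewrite eq_sym => ->.
  rewrite big1// => a aG; case: eqP => // E; by rewrite E aG in ijG.
rewrite (eq_bigr (fun=> 2%N)) => [|a aG]; first by rewrite sum_nat_const mulnC.
by rewrite edge_ends ?G2.
Qed.

Lemma adjacency_rowsum (G : {set {set 'I_n}}) i :
  \sum_j adjacency R G i j = (\sum_j ([set i; j]%SET \in G))%:R.
Proof. by rewrite natr_sum; apply: eq_bigr => j _; rewrite mxE. Qed.

Lemma adjacency_calM e (G : {set {set 'I_n}}) : calG n e G ->
  calM R n e (adjacency R G).
Proof.
move=> [G2 Ge]; split.
- exact: adjacency_sym.
- by move=> i j; rewrite mxE ler0n.
- by move=> i; rewrite adjacency_rowsum intr_nat.
by rewrite -Ge -degree_sum// natr_sum; apply: eq_bigr => i _; rewrite adjacency_rowsum.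
Qed.

Definition edges_of (E : rel 'I_n) : {set {set 'I_n}} :=
  [set [set p.1; p.2] | p : 'I_n * 'I_n & E p.1 p.2]%SET.

Lemma edges_ofE (E : rel 'I_n) i j : symmetric E ->
  ([set i; j]%SET \in edges_of E) = E i j.
Proof.
move=> Esym; apply/finset.imsetP/idP => [[[k l]]|Eij]; last first.
  by exists (i, j); rewrite ?inE.
rewrite inE /= => Ekl E2.
have : i \in [set k; l]%SET by rewrite -E2 !inE eqxx.
have : j \in [set k; l]%SET by rewrite -E2 !inE eqxx orbT.
have : k \in [set i; j]%SET by rewrite E2 !inE eqxx.
have : l \in [set i; j]%SET by rewrite E2 !inE eqxx orbT.
rewrite !inE => /orP[]/eqP ? /orP[]/eqP ? /orP[]/eqP ? /orP[]/eqP ?; subst => //.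
all: by rewrite Esym.
Qed.

Lemma edges_of_card (E : rel 'I_n) a : irreflexive E -> a \in edges_of E -> #|a| = 2%N.
Proof.
move=> Eirr /finset.imsetP [[k l]]; rewrite inE /= => Ekl ->.
by rewrite cards2; case: eqP => // kl; rewrite kl Eirr in Ekl.
Qed.

End Adjacency.

(** * Semiregular bipartite graphs and circulants *)

Local Open Scope nat_scope.

Lemma sum_blocks n k (F : nat -> nat) :
  \sum_(0 <= u < n * k) F u = \sum_(0 <= i < n) \sum_(0 <= l < k) F (i * k + l).
Proof.
rewrite big_nat_mul; apply: eq_bigr => i _.
rewrite -{1}(add0n (i * k)) big_addn mulSn addnK.
by apply: eq_bigr => l _; rewrite addnC.
Qed.

Lemma sum_nat_eq1 k r : r < k -> \sum_(0 <= j < k) (r == j) = 1.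
Proof.
move=> r_lt; rewrite (bigD1_seq r) ?iota_uniq ?mem_index_iota//= eqxx.
by rewrite big1// => j /negPf; rewrite eq_sym => ->.
Qed.

Section CyclicAdjacency.
Variables (s y : nat).

(** Number [x * s] half-edges consecutively and wind them around a cycle of length
[y]; vertex [i] owns the half-edges [i * s, ..., i * s + s - 1].  The number of
those that land on [j] is at most one when [s <= y]. *)
Definition cyclic_hits (i j : nat) := \sum_(0 <= l < s) ((i * s + l) %% y == j).

Definition cyclic_adj (i j : nat) : bool := 0 < cyclic_hits i j.

Lemma cyclic_adjE i j : s <= y -> cyclic_adj i j = cyclic_hits i j :> nat.
Proof.
move=> sy; rewrite /cyclic_adj.
suff : cyclic_hits i j <= 1 by case: (cyclic_hits i j) => [|[]].
have -> : cyclic_hits i j = #|[pred l : 'I_s | (i * s + l) %% y == j]|.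
  rewrite /cyclic_hits big_mkord -sum1_card [in RHS]big_mkcond.
  by apply: eq_bigr => l _; rewrite inE; case: eqP.
apply/card_le1_eqP => l l'; rewrite !inE => /eqP <-; rewrite eqn_modDl.
have l_lt (k : 'I_s) : k < y by rewrite (leq_trans _ sy).
by rewrite !modn_small ?l_lt// => /eqP ?; apply/val_inj.
Qed.

Lemma cyclic_adj_row i : s <= y -> 0 < y -> \sum_(0 <= j < y) cyclic_adj i j = s.
Proof.
move=> sy y_gt0; under eq_bigr => j _ do rewrite cyclic_adjE//.
rewrite exchange_big /= (eq_bigr (fun=> 1)) => [|l _]; last first.
  by rewrite sum_nat_eq1// ltn_mod.
by rewrite sum_nat_const_nat muln1 subn0.
Qed.

(** The [x * s = k * y] half-edges wind exactly [k] times around the cycle. *)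
Lemma cyclic_adj_col x k j : s <= y -> j < y -> x * s = k * y ->
  \sum_(0 <= i < x) cyclic_adj i j = k.
Proof.
move=> sy j_lt xs; under eq_bigr => i _ do rewrite cyclic_adjE//.
rewrite /cyclic_hits -(sum_blocks x s (fun u => nat_of_bool (u %% y == j))) xs sum_blocks.
rewrite (eq_bigr (fun=> 1)) => [|i _]; first by rewrite sum_nat_const_nat muln1 subn0.
rewrite -(sum_nat_eq1 j_lt); apply: eq_big_nat => l /andP[_ l_lt].
by rewrite modnMDl modn_small// eq_sym.
Qed.

End CyclicAdjacency.

Section Circulant.
Variables (r y : nat).
Hypothesis r_lt : r < y.

(** A set of [r] differences, symmetric under [d |-> y - d] and avoiding [0]: the
interval centred at [y / 2].  When [y - r] is even the interval has one element
too many, and its centre is left out. *)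
Definition circulant_gap (d : nat) : bool :=
  let lo := (y - r).+1./2 in
  (lo <= d <= y - lo) && (odd (y - r) || (2 * d != y)).

Lemma circulant_gap0 : circulant_gap 0 = false.
Proof. by rewrite /circulant_gap; case: leqP => //=; lia. Qed.

Lemma circulant_gap_sym d : d <= y -> circulant_gap (y - d) = circulant_gap d.
Proof. by rewrite /circulant_gap => d_le; congr (_ && (_ || _)); apply/idP/idP; lia. Qed.

Lemma sum_interval lo hi k : lo <= hi.+1 -> hi < k ->
  \sum_(0 <= d < k) (lo <= d <= hi) = hi.+1 - lo.
Proof.
move=> lohi hik; rewrite (@big_cat_nat _ _ _ lo) //=; last by lia.
rewrite (@big_cat_nat _ _ _ hi.+1 lo) //=.
have out a b : b <= lo \/ hi < a -> \sum_(a <= d < b) (lo <= d <= hi) = 0.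
  by move=> ab; rewrite big_nat big1 => // d dP; apply/eqP; rewrite eqb0; lia.
rewrite (out 0 lo) ?(out hi.+1 k) ?add0n ?addn0; [|by right|by left].
rewrite big_nat (eq_bigr (fun=> 1)) -?big_nat => [|d ->//].
by rewrite sum_nat_const_nat muln1.
Qed.

(** If [y - r] is even then so is [y], because [y * r] is even; hence the omitted
centre [y./2] really is an element of the interval. *)
Lemma circulant_gap_sum : ~~ odd (y * r) -> \sum_(0 <= d < y) circulant_gap d = r.
Proof.
move=> yr; have [oyr|eyr] := boolP (odd (y - r)).
  rewrite /circulant_gap oyr; under eq_bigr => d _ do rewrite andbT.
  rewrite sum_interval; lia.
have lo_gt0 : 0 < (y - r).+1./2 by lia.
have y2 : 2 * y./2 = y by rewrite oddM in yr; lia.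
(* Put the centre back, so that the whole interval is counted. *)
apply: (@addnI 1); rewrite -{1}(@sum_nat_eq1 y y./2); last by lia.
rewrite -big_split /=.
rewrite (eq_bigr (fun d => (y - r).+1./2 <= d <= y - (y - r).+1./2 : nat)).
  rewrite sum_interval; lia.
move=> d _; rewrite /circulant_gap (negPf eyr) /=; have [<-|yd] := eqVneq y./2 d.
  by rewrite y2 eqxx andbF; lia.
have -> : (2 * d != y) by lia.
by rewrite andbT.
Qed.

(** The differences to the vertices below [i] and above [i] together run once over
all residues, by the symmetry of the set of gaps. *)
Lemma circulant_row i : ~~ odd (y * r) -> i < y ->
  \sum_(0 <= j < y) circulant_gap ((i - j) + (j - i)) = r.
Proof.
move=> yr i_lt; rewrite -[RHS](circulant_gap_sum yr).
rewrite (@big_cat_nat _ _ _ i) //=; last by lia.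
rewrite [RHS](@big_cat_nat _ _ _ (y - i)) //=; last by lia.
rewrite addnC; congr (_ + _).
  rewrite -{1}(add0n i) big_addn; apply: eq_big_nat => j _.
  congr (circulant_gap _ : nat); lia.
rewrite -{1}(add0n (y - i)) big_addn subKn ?(ltnW i_lt)//.
apply: eq_big_nat => j /andP[_ j_lt]; rewrite -circulant_gap_sym; last by lia.
congr (circulant_gap _ : nat); lia.
Qed.

End Circulant.

Local Open Scope ring_scope.

(** * Graphs attaining the bound *)

(** A circulant graph of degree [t - k] on [y] vertices exists because
[y * (t - k) = 2 * e - 2 * x * s] is even. *)
Lemma biregular_graph_exists (R : realType) (x s y t k e : nat) :
  (y * k = x * s)%N -> (s <= y)%N -> (k <= t)%N -> (t - k < y)%N ->
  (x * s + y * t = 2 * e)%N ->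
  exists2 G, calG (x + y) e G & equitable (adjacency R G) s t k%:R.
Proof.
move=> yk sy kt tky e2.
pose f (i j : nat) :=
  if (i < x)%N then (if (j < x)%N then false else cyclic_adj s y i (j - x))
  else if (j < x)%N then cyclic_adj s y j (i - x)
  else circulant_gap (t - k) y ((i - x - (j - x)) + (j - x - (i - x)))%N.
pose E : rel 'I_(x + y) := fun i j => f i j.
have Esym : symmetric E.
  by move=> i j; rewrite /E /f; case: ifP => // _; case: ifP => // _; rewrite addnC.
have Eirr : irreflexive E.
  by move=> i; rewrite /E /f; case: (ltnP i x) => // _; rewrite subnn circulant_gap0.
have adjE i j : adjacency R (edges_of E) i j = (f i j)%:R by rewrite mxE edges_ofE.
have parity : ~~ odd (y * (t - k)).
  have : (2 * x * s + y * (t - k) = 2 * e)%N by rewrite mulnBr; nia.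
  by lia.
have eqt : equitable (adjacency R (edges_of E)) s t k%:R.
  split=> j jx; split.
  - by rewrite big1// => i ix; rewrite adjE /f ix jx.
  - under eq_bigr => i _ do rewrite adjE.
    rewrite (sum_ord_high x y (fun i => (f i j)%:R)) -natr_sum; congr _%:R.
    rewrite -[RHS](cyclic_adj_row j sy); last by lia.
    by apply: eq_bigr => i _; rewrite /f ltnNge leq_addr jx addKn.
  - under eq_bigr => i _ do rewrite adjE.
    rewrite (sum_ord_low x y (fun i => (f i j)%:R)) -natr_sum; congr _%:R.
    rewrite -(@cyclic_adj_col s y x k (j - x) sy); last first.
    + by rewrite -yk mulnC.
    + by have := ltn_ord j; lia.
    by apply: eq_big_nat => i /andP[_ ix]; rewrite /f ix (negPf jx).
  under eq_bigr => i _ do rewrite adjE.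
  rewrite (sum_ord_high x y (fun i => (f i j)%:R)) -natr_sum -natrB//; congr _%:R.
  rewrite -[RHS](@circulant_row _ _ tky (j - x) parity); last by have := ltn_ord j; lia.
  apply: eq_bigr => i _; rewrite /f ltnNge leq_addr (negPf jx) addKn /=.
  by rewrite addnC.
exists (edges_of E) => //; have G2 a := @edges_of_card _ E a Eirr.
split=> //; apply/eqP; rewrite -(@eqn_pmul2l 2)// -degree_sum//.
have adj_ge0 i j : 0 <= adjacency R (edges_of E) i j by rewrite adjE ler0n.
have [_ _ _ Mtot] := equitable_calM (adjacency_sym R _) adj_ge0 eqt e2.
rewrite -(eqr_nat R) -Mtot natr_sum; apply/eqP; apply: eq_bigr => i _.
by rewrite adjacency_rowsum.
Qed.

(** With [K j] and [L j] the numbers of neighbours of [j] of degree [s] and [t], the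
eigenvector equation at [j] determines [K j]: it is zero if [j] has degree [s]
and a constant if [j] has degree [t].  Counting the edges between the two degree
classes from both sides gives [y * K = x * s]; the two inequalities hold because
neighbours are distinct and a vertex is not its own neighbour. *)
Lemma extremal_graph_structure (R : realType) n e (G : {set {set 'I_n}}) (lam : R)
    (x s y t : nat) :
  calG n e G -> (x + y)%N = n -> (x * s + y * t = 2 * e)%N ->
  (0 < x)%N -> (0 < y * t)%N -> 0 < lam -> between s t lam ->
  x%:R * (s%:R * (s%:R - lam)) + y%:R * (lam * (t%:R - lam)) = 0 ->
  spectral_radius (adjacency R G) = lam ->
  [/\ (y %| x * s)%N, (s <= y)%N & (t - x * s %/ y < y)%N].
Proof.
move=> GP xy e2 x_gt0 yt_gt0 lam_gt0 st lamE rhoE.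
have [G2 Ge] := GP.
have [Msym M_ge0 _ _] := adjacency_calM R GP.
pose a i j : nat := [set i; j]%SET \in G.
have aC i j : a i j = a j i by rewrite /a finset.setUC.
have aii i : a i i = 0%N.
  by rewrite /a finset.setUid; case: (boolP (_ \in G)) => // /G2; rewrite cards1.
pose d i := (\sum_j a i j)%N.
have d_sum : (\sum_i d i = x * s + y * t)%N by rewrite degree_sum// Ge.
have n_gt0 : (0 < n)%N by lia.
have [_ /(_ rhoE) [d_st eigen]] := two_degree_lower_bound n_gt0 Msym M_ge0
  (adjacency_rowsum R G) xy d_sum yt_gt0 lam_gt0 st lamE.
have {}d_st i : d i = s \/ d i = t by exact: d_st.
have s_neq_t : (s == t) = false by case: st => -[-> _]; lia.
have s_neq_lam : s%:R - lam != 0.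
  by rewrite subr_eq0; case: st => -[_ /andP[]] ? ?; [rewrite lt_eqF|rewrite gt_eqF].
pose K j := (\sum_(i | d i == s) a i j)%N.
pose L j := (\sum_(i | d i != s) a i j)%N.
have KL j : (K j + L j = d j)%N.
  by rewrite /d (bigID (fun i => d i == s)) /=; congr (_ + _)%N; apply: eq_bigr.
have w_s : test_weight lam s t s = s%:R by rewrite /test_weight /s_side leqnn if_same.
have w_t : test_weight lam s t t = lam.
  rewrite /test_weight (_ : s_side s t t = false)//.
  by rewrite /s_side; case: st => -[-> _]; case: ifP => h; lia.
have KL_eigen j : s%:R * (K j)%:R + lam * (L j)%:R = lam * test_weight lam s t (d j).
  rewrite -eigen (bigID (fun i => d i == s)) /= !natr_sum !mulr_sumr.
  congr (_ + _); apply: eq_bigr => i; rewrite mxE.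
    by move=> /eqP dis; rewrite [X in test_weight _ _ _ X](_ : _ = s)// w_s.
  move=> dis; have [dis'|dit] := d_st i; first by rewrite dis' eqxx in dis.
  by rewrite [X in test_weight _ _ _ X](_ : _ = t)// w_t.
have K_low j : d j = s -> K j = 0%N.
  move=> djs; have := KL_eigen j; rewrite djs w_s => E.
  have : (s%:R - lam) * (K j)%:R = 0.
    have <- : s%:R * (K j)%:R + lam * (L j)%:R - lam * s%:R = 0 by rewrite E subrr.
    by rewrite -{3}djs -KL natrD; ring.
  by move/eqP; rewrite mulf_eq0 (negPf s_neq_lam) pnatr_eq0 => /eqP.
have K_high j : d j = t -> (s%:R - lam) * (K j)%:R = lam * (lam - t%:R).
  move=> djt; have := KL_eigen j; rewrite djt w_t => E.
  by rewrite mulrBr -E -djt -KL natrD; ring.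
pose p := #|[pred i | d i == s]|; pose q := #|[pred i | d i != s]|.
have pq : (p + q = x + y)%N by rewrite xy -[n]card_ord -(cardC [pred i | d i == s]).
have pq_sum : (p * s + q * t = x * s + y * t)%N.
  rewrite -d_sum (bigID (fun i => d i == s)) /= -!sum_nat_const.
  congr (_ + _)%N; apply: eq_bigr => i; first by move/eqP.
  by rewrite inE => dis; case: (d_st i) => // dis'; rewrite dis' eqxx in dis.
(* Two linear equations in [p] and [q] whose determinant is [t - s], a unit. *)
have [px qy] : p = x /\ q = y by case: st => -[st _]; subst; split; nia.
have [i0 i0s] : exists i, d i = s.
  have /card_gt0P [i /eqP] : (0 < p)%N by rewrite px.
  by exists i.
have [j0 j0t] : exists j, d j = t.
  have /card_gt0P [j] : (0 < q)%N by rewrite qy; case: (y) yt_gt0.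
  by rewrite inE; case: (d_st j) => [->|]; rewrite ?eqxx//; exists j.
have a_le1 i j : (a i j <= 1)%N by rewrite /a leq_b1.
have yK : (y * K j0 = x * s)%N.
  transitivity (\sum_(j | d j != s) K j)%N.
    rewrite -qy -sum_nat_const; apply: eq_bigr => j djs.
    have {}djs : d j != s := djs.
    have djt : d j = t by case: (d_st j) => // djs'; rewrite djs' eqxx in djs.
    apply/eqP; rewrite -(eqr_nat R); apply/eqP/(mulfI s_neq_lam).
    by rewrite !K_high.
  rewrite exchange_big /= -px -sum_nat_const; apply: eq_bigr => i /eqP dis.
  rewrite -[RHS]dis -KL K_low// add0n; apply: eq_bigr => j _; exact: aC.
have y_gt0 : (0 < y)%N by case: (y) yt_gt0.
split.
- by rewrite -yK dvdn_mulr.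
- rewrite -i0s -KL K_low// add0n -qy /q -sum1_card /L; exact: leq_sum.
rewrite -yK mulKn// -{1}j0t -KL addKn -qy /q -sum1_card /L.
have j0J : d j0 != s by rewrite j0t eq_sym s_neq_t.
by rewrite (bigD1 j0)//= aii add0n [ltnRHS](bigD1 j0)//= add1n ltnS leq_sum.
Qed.

Lemma calM_degrees (R : realType) n e (M : 'M[R]_n) : calM R n e M ->
  exists2 d : 'I_n -> nat, (forall i, \sum_j M i j = (d i)%:R) &
    (\sum_i d i = 2 * e)%N.
Proof.
move=> [Msym M_ge0 M_int M_sum].
have Md i : \sum_j M i j = (Num.truncn (\sum_j M i j))%:R.
  by apply/esym/truncnK; rewrite natrEint M_int sumr_ge0.
exists (fun i => Num.truncn (\sum_j M i j)) => //.
apply/eqP; rewrite -(eqr_nat R) -M_sum natr_sum; apply/eqP.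
by apply: eq_bigr => i _; rewrite -Md.
Qed.

(** Both minima are compared with [lam]: the lower bound holds for all matrices and
the block matrix attains it, so equality means that some graph attains it. *)
Lemma rho_eq_iff (R : realType) (x s y t e : nat) :
  (0 < x)%N -> (0 < y * t)%N -> (x * s <= y * t)%N -> t = s.+1 \/ s = t.+1 ->
  (x * s + y * t = 2 * e)%N ->
  rho_eq R (x + y) e <->
  [&& y %| x * s, s <= y & t - x * s %/ y < y]%N.
Proof.
move=> x_gt0 yt_gt0 xs_le st e2.
have [lam [lam_gt0 btw lamE]] := two_degree_root R xs_le x_gt0 yt_gt0 st.
have y_gt0 : (0 < y)%N by case: (y) yt_gt0.
have n_gt0 : (0 < x + y)%N by lia.
have lower M : calM R (x + y) e M -> lam <= spectral_radius M.
  move=> MP; have [d Md d_sum] := calM_degrees MP; have [Msym M_ge0 _ _] := MP.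
  rewrite -e2 in d_sum.
  by have [] := two_degree_lower_bound n_gt0 Msym M_ge0 Md erefl d_sum
    yt_gt0 lam_gt0 btw lamE.
split=> [[r [[[G GP Gr] _] [_ r_min]]]|/and3P[ydvd sy ty]].
  have [M [k [MP Meq yk]]] := blowup_exists R xs_le y_gt0 e2.
  have [_ M_ge0 _ _] := MP.
  have rhoG : spectral_radius (adjacency R G) = lam.
    apply/eqP; rewrite eq_le lower ?andbT; last exact: adjacency_calM.
    rewrite Gr; apply: le_trans (equitable_radius_le M_ge0 Meq yt_gt0 yk lam_gt0 btw lamE).
    by apply: r_min; exists M.
  by apply/and3P; have [] := extremal_graph_structure GP erefl e2 x_gt0 yt_gt0
    lam_gt0 btw lamE rhoG.
set k := (x * s %/ y)%N in ty.
have yk : (y * k = x * s)%N by rewrite mulnC divnK.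
have kt : (k <= t)%N by rewrite -(leq_pmul2l y_gt0) yk.
have [G GP Geq] := biregular_graph_exists R yk sy kt ty e2.
have GM := adjacency_calM R GP; have [_ G_ge0 _ _] := GM.
have rhoG : spectral_radius (adjacency R G) = lam.
  apply/eqP; rewrite eq_le lower// andbT.
  apply: (equitable_radius_le G_ge0 Geq) => //.
  by rewrite -!natrM yk.
exists lam; split; split.
- by exists G.
- by move=> _ [G' GP' <-]; apply: lower; exact: adjacency_calM.
- by exists (adjacency R G).
by move=> _ [M MP <-]; exact: lower.
Qed.

(** * Pillai's function and half sums of gcds *)

Local Open Scope nat_scope.

Lemma sum_multiples d k (F : nat -> nat) : 0 < d ->
  \sum_(1 <= b < (k * d).+1) (d %| b) * F b = \sum_(1 <= j < k.+1) F (j * d).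
Proof.
move=> d_gt0; rewrite !big_add1 /= sum_blocks; apply: eq_bigr => i _.
case: d d_gt0 => // d _; rewrite big_nat_recr//= -[RHS]add0n; congr (_ + _).
  apply: big1_seq => l; rewrite mem_index_iota => /andP[_ /andP[_ l_lt]].
  rewrite (_ : (d.+1 %| _) = false)// -addnS dvdn_addr ?dvdn_mull//.
  by rewrite gtnNdvd.
by rewrite -addnS -mulSnr dvdn_mull ?mul1n.
Qed.

Lemma gcdn_sum_totient n b : 0 < n ->
  gcdn n b = \sum_(d <- divisors n) (d %| b) * totient d.
Proof.
move=> n_gt0; have g_gt0 : 0 < gcdn n b by rewrite gcdn_gt0 n_gt0.
rewrite -{1}[gcdn n b]sum_totient_dvd.
rewrite -(big_mkord (fun d => d %| gcdn n b) totient) -big_filter.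
under [RHS]eq_bigr => d _ do rewrite mulnbl.
rewrite -big_mkcond -[RHS]big_filter; apply: perm_big; apply: uniq_perm.
- by rewrite filter_uniq ?iota_uniq.
- by rewrite filter_uniq ?divisors_uniq.
move=> d; rewrite !mem_filter mem_index_iota -dvdn_divisors// dvdn_gcd.
case: (boolP (d %| n)); rewrite ?andbF//= andbT => dn; case: (boolP (d %| b)) => //= db.
by rewrite ltnS dvdn_leq// dvdn_gcd dn.
Qed.

(** The map [d |-> n / d] permutes the divisors of [n]. *)
Lemma sum_divisors_codiv (V : nmodType) n (F : nat -> V) : 0 < n ->
  (\sum_(d <- divisors n) F (n %/ d)%N = \sum_(d <- divisors n) F d)%R.
Proof.
move=> n_gt0; rewrite -(big_map (fun d => n %/ d) xpredT F).
have divK d : d \in divisors n -> n %/ (n %/ d) = d.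
  by rewrite -dvdn_divisors// => dn; rewrite divnA// mulKn.
apply: perm_big; apply: uniq_perm; rewrite ?divisors_uniq//.
  rewrite map_inj_in_uniq ?divisors_uniq// => d d' dn d'n E.
  by rewrite -(divK d)// E divK.
move=> d; apply/mapP/idP => [[d' d'n ->]|dn].
  by move: d'n; rewrite -!dvdn_divisors// => d'n; exact: dvdn_div.
exists (n %/ d); last by rewrite divK.
by move: dn; rewrite -!dvdn_divisors// => dn; exact: dvdn_div.
Qed.

Lemma pillai_sum_totient n : 0 < n ->
  pillai n = \sum_(d <- divisors n) totient d * (n %/ d).
Proof.
move=> n_gt0; rewrite /pillai; under eq_bigr => b _ do rewrite gcdn_sum_totient//.
rewrite exchange_big /=; apply: eq_big_seq => d; rewrite -dvdn_divisors// => dn.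
have d_gt0 := dvdn_gt0 n_gt0 dn.
rewrite -{1}(divnK dn) (sum_multiples _ (fun=> totient d))//.
by rewrite sum_nat_const_nat subn1 mulnC.
Qed.

Definition odd_lt_half (n b : nat) : bool := odd b && (2 * b < n).

Definition half_gcd_sum (n : nat) := \sum_(1 <= b < n) odd_lt_half n b * gcdn n b.

Definition half_odd_count (n : nat) := \sum_(1 <= b < n) odd_lt_half n b.

(** Since [n] is odd, so are its divisors [d], and [d * c] is odd and below [n / 2]
exactly when [c] is odd and below [(n / d) / 2]. *)
Lemma half_gcd_sum_totient n : odd n ->
  half_gcd_sum n = \sum_(d <- divisors n) totient d * half_odd_count (n %/ d).
Proof.
move=> n_odd; have n_gt0 := odd_gt0 n_odd.
have -> : half_gcd_sum n = \sum_(1 <= b < n.+1) odd_lt_half n b * gcdn n b.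
  rewrite big_nat_recr//= [X in _ + X](_ : _ = 0) ?addn0//.
  by rewrite /odd_lt_half mul2n -addnn ltnNge leq_addr andbF.
under eq_bigr => b _ do rewrite gcdn_sum_totient// big_distrr.
rewrite exchange_big /=; apply: eq_big_seq => d; rewrite -dvdn_divisors// => dn.
have d_gt0 := dvdn_gt0 n_gt0 dn; have d_odd := dvdn_odd dn n_odd.
under eq_bigr => b _ do rewrite mulnCA.
rewrite -{1}(divnK dn) (sum_multiples _ (fun b => odd_lt_half n b * totient d))//.
have k_gt0 : 0 < n %/ d by rewrite divn_gt0// dvdn_leq.
rewrite /half_odd_count big_distrr /= big_nat_recr//= [X in _ + X](_ : _ = 0) ?addn0.
  apply: eq_bigr => c _; rewrite mulnC; congr (_ * nat_of_bool _).
  by rewrite /odd_lt_half oddM d_odd andbT mulnA -{1}(divnK dn) ltn_pmul2r.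
by rewrite divnK// /odd_lt_half mul2n -addnn ltnNge leq_addr andbF.
Qed.

Lemma sum_odd h : \sum_(1 <= b < h.+1) odd b = uphalf h.
Proof.
elim: h => [|h IHh]; first by rewrite big_nil.
by rewrite big_nat_recr//= IHh; lia.
Qed.

(** The last integer below [k / 2] is [k./2], and [uphalf k./2] odd numbers are at
most [k./2]. *)
Lemma half_odd_countE k : odd k -> ((4 * half_odd_count k)%:Z = k%:Z - chi4 k)%R.
Proof.
move=> k_odd; have k2 := odd_double_half k; rewrite k_odd in k2.
have -> : half_odd_count k = uphalf k./2.
  rewrite -sum_odd /half_odd_count (@big_cat_nat _ _ _ k./2.+1) //=; [|lia..].
  rewrite [X in _ + X](_ : _ = 0) ?addn0; last first.
    rewrite big_nat big1// => b b_ge.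
    by rewrite /odd_lt_half (_ : (2 * b < k) = false) ?andbF//; lia.
  apply: eq_big_nat => b b_lt; rewrite /odd_lt_half (_ : (2 * b < k) = true) ?andbT//.
  lia.
rewrite /chi4; case: eqP => k4; [|case: eqP => k4']; lia.
Qed.

Lemma half_gcd_sumE n : odd n ->
  ((4 * half_gcd_sum n)%:Z = (pillai n)%:Z - chi4_totient n)%R.
Proof.
move=> n_odd; have n_gt0 := odd_gt0 n_odd.
rewrite half_gcd_sum_totient// pillai_sum_totient// /chi4_totient.
rewrite -(@sum_divisors_codiv _ n (fun d => chi4 d * (totient (n %/ d))%:Z)%R)//.
rewrite big_distrr /= !(big_morph Posz PoszD erefl) -sumrB.
apply: eq_big_seq => d; rewrite -dvdn_divisors// => dn.
have k_odd : odd (n %/ d) by apply: dvdn_odd n_odd; exact: dvdn_div.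
rewrite divnA// mulKn// mulnCA !PoszM.
have := half_odd_countE k_odd; rewrite PoszM => ->; ring.
Qed.

(** * Counting quotients and remainders by gcds *)

(** Pairs coming from both cases of the characterization.  The first inequality
belongs to [b] rows of sum [q + 1] dominating the [n - b] rows of sum [q]; the
second to the opposite case, reindexed so that [b] stands for the number of rows
of the smaller sum and [q] for the larger sum. *)
Definition pairs_count n := \sum_(1 <= b < n) \sum_(1 <= q < b.+1)
  (b %| n * q)%N * (~~ odd (q * n + b) *
     ((n * q <= b * (2 * q + 1)) + (n * q + b < 2 * (b * q)))).

Definition reduced_l n b := (n %/ gcdn n b)%N.
Definition reduced_r n b := (b %/ gcdn n b)%N.

(** By Gauss's lemma [b] divides [n * q] exactly when [b / gcdn n b] divides [q]. *)
Lemma sum_dvd_mul n b (F : nat -> nat) : 0 < n -> 0 < b ->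
  \sum_(1 <= q < b.+1) (b %| n * q)%N * F q =
  \sum_(1 <= j < (gcdn n b).+1) F (j * reduced_r n b).
Proof.
move=> n_gt0 b_gt0; set g := gcdn n b.
have g_gt0 : 0 < g by rewrite gcdn_gt0 n_gt0.
have bE : b = g * reduced_r n b by rewrite mulnC divnK// dvdn_gcdr.
have nE : n = g * reduced_l n b by rewrite mulnC divnK// dvdn_gcdl.
have co : coprime (reduced_r n b) (reduced_l n b).
  by rewrite /coprime -(eqn_pmul2l g_gt0) muln_gcdr -bE -nE gcdnC muln1.
have c_gt0 : 0 < reduced_r n b by rewrite divn_gt0// dvdn_leq// dvdn_gcdr.
rewrite -(sum_multiples _ _ c_gt0) -bE; apply: eq_bigr => q _; congr (nat_of_bool _ * _).
by rewrite [X in (X %| _)%N]bE [X in (_ %| X * q)%N]nE -mulnA dvdn_pmul2l// Gauss_dvdr.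
Qed.

Lemma gcdn_subr n b : b <= n -> gcdn n (n - b) = gcdn n b.
Proof.
move=> b_le; rewrite gcdnC -{2}(subnK b_le) gcdnDl gcdnC -gcdnDl.
by rewrite subnKC// gcdnC.
Qed.

(** In the second summand [b] has been replaced by [n - b], which preserves the gcd
and makes the two inequalities complementary. *)
Definition gcd_term n b j :=
  ~~ odd (j * reduced_r n b * n + b) *
    (j * reduced_l n b <= 2 * (j * reduced_r n b) + 1) +
  ~~ odd (j * (reduced_l n b - reduced_r n b) * n + (n - b)) *
    (2 * (j * reduced_r n b) + 1 < j * reduced_l n b).

Lemma pairs_countE n : pairs_count n =
  \sum_(1 <= b < n) \sum_(1 <= j < (gcdn n b).+1) gcd_term n b j.
Proof.
have coE b : 0 < b < n ->
    [/\ 0 < gcdn n b, n = gcdn n b * reduced_l n b & b = gcdn n b * reduced_r n b].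
  move=> /andP[b_gt0 _]; split; first by rewrite gcdn_gt0 b_gt0 orbT.
    by rewrite mulnC divnK// dvdn_gcdl.
  by rewrite mulnC divnK// dvdn_gcdr.
transitivity (\sum_(1 <= b < n) \sum_(1 <= j < (gcdn n b).+1)
    (~~ odd (j * reduced_r n b * n + b) *
       (j * reduced_l n b <= 2 * (j * reduced_r n b) + 1) +
     ~~ odd (j * reduced_r n b * n + b) *
       (j * reduced_l n b + 1 < 2 * (j * reduced_r n b)))).
  apply: eq_big_nat => b b_lt; have [g_gt0 nE bE] := coE b b_lt.
  rewrite sum_dvd_mul; [|by lia|by lia]; apply: eq_bigr => j _.
  have -> : n * (j * reduced_r n b) = b * (j * reduced_l n b).
    by rewrite [X in X * _ = _]nE [X in _ = X * _]bE; ring.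
  rewrite mulnDr; congr (_ * nat_of_bool _ + _ * nat_of_bool _).
    by rewrite leq_pmul2l//; lia.
  by rewrite -mulnSr mulnCA ltn_pmul2l ?addn1//; lia.
under eq_bigr do rewrite big_split; rewrite big_split /=.
rewrite [X in _ + X]big_nat_rev /= -big_split /=; apply: eq_big_nat => b b_lt.
have [g_gt0 nE bE] := coE b b_lt.
have gE : gcdn n (1 + n - b.+1) = gcdn n b.
  by rewrite add1n subSS gcdn_subr//; lia.
have rE : reduced_r n (1 + n - b.+1) = reduced_l n b - reduced_r n b.
  rewrite /reduced_r gE add1n subSS.
  by rewrite [X in ((X - _) %/ _)%N]nE [X in ((_ - X) %/ _)%N]bE -mulnBr mulKn.
have lE : reduced_l n (1 + n - b.+1) = reduced_l n b by rewrite /reduced_l gE.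
rewrite gE rE lE -big_split /=; apply: eq_bigr => j _.
rewrite /gcd_term add1n subSS; congr (_ + _ * nat_of_bool _).
have : reduced_r n b <= reduced_l n b by rewrite leq_div2r//; lia.
move: (reduced_r n b) (reduced_l n b) => r l rl; apply/idP/idP; nia.
Qed.

Lemma pairs_count_even n : ~~ odd n ->
  pairs_count n = \sum_(1 <= b < n) ~~ odd b * gcdn n b.
Proof.
move=> n_even; rewrite pairs_countE; apply: eq_big_nat => b b_lt.
rewrite (eq_big_nat _ _ (F2 := fun=> ~~ odd b : nat)) => [|j _].
  by rewrite sum_nat_const_nat subn1 mulnC.
rewrite /gcd_term !oddD !oddM (negPf n_even) !andbF /= oddB; last by lia.
rewrite (negPf n_even) /= [2 * (j * _) + 1 < _]ltnNge -mulnDr.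
by case: leqP => _; rewrite muln1.
Qed.

(** For odd [n] the number [n / g] is odd.  If [j] is odd, both parities are even and
exactly one inequality holds.  If [j] is even, the inequalities reduce to
comparing [2 * b] with [n], and the parities to those of [b] and [n - b]. *)
Lemma gcd_term_odd n b j : odd n -> 0 < b < n -> 0 < j ->
  gcd_term n b j = odd j + ~~ odd j * (odd_lt_half n b + odd_lt_half n (n - b)).
Proof.
move=> n_odd b_lt j_gt0; rewrite /gcd_term /odd_lt_half.
have g_gt0 : 0 < gcdn n b by rewrite gcdn_gt0; lia.
have nE : n = gcdn n b * reduced_l n b by rewrite mulnC divnK// dvdn_gcdl.
have bE : b = gcdn n b * reduced_r n b by rewrite mulnC divnK// dvdn_gcdr.
have /andP[g_odd l_odd] : odd (gcdn n b) && odd (reduced_l n b) by rewrite -oddM -nE.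
have r_odd : odd (reduced_r n b) = odd b by rewrite [in RHS]bE oddM g_odd.
have lr : reduced_r n b <= reduced_l n b by rewrite leq_div2r//; lia.
have lt1 : (2 * b < n) = (2 * reduced_r n b < reduced_l n b).
  by rewrite -[RHS](ltn_pmul2l g_gt0) mulnCA -bE -nE.
rewrite !oddD !oddM n_odd oddB// oddB ?l_odd ?r_odd ?n_odd//=; last by lia.
have -> : (2 * (n - b) < n) = ~~ (2 * reduced_r n b < reduced_l n b).
  by rewrite -lt1; lia.
rewrite lt1.
have cmp : ~~ odd j -> (j * reduced_l n b <= 2 * (j * reduced_r n b) + 1) =
    ~~ (2 * reduced_r n b < reduced_l n b).
  move=> j_even; rewrite mulnCA -leqNgt; apply/idP/idP => [jl|lr2]; last first.
    by rewrite (leq_trans (leq_mul (leqnn j) lr2))// leq_addr.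
  rewrite leqNgt; apply/negP => lr2.
  have := leq_trans (leq_mul (leqnn j) lr2) jl; rewrite mulnS; lia.
rewrite [2 * (j * _) + 1 < _]ltnNge.
case: (boolP (odd j)) => jo /=.
  by rewrite mul0n; case: (odd b); case: (j * _ <= _).
by rewrite cmp//; case: (2 * _ < _); case: (odd b).
Qed.

Lemma sum_parity g h : \sum_(1 <= j < g.+1) (odd j + ~~ odd j * h) = uphalf g + g./2 * h.
Proof.
elim: g => [|g IHg]; first by rewrite big_nil.
rewrite big_nat_recr//= IHg uphalf_half; case: (odd g) => /=; lia.
Qed.

(** The reflection [b |-> n - b] identifies the two sums that arise from even [j],
which explains the factors 2. *)
Lemma pairs_count_odd n : odd n ->
  2 * pairs_count n + 2 * half_odd_count n =
  \sum_(1 <= b < n) (gcdn n b + 1) + 2 * half_gcd_sum n.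
Proof.
move=> n_odd; pose h b := odd_lt_half n b + odd_lt_half n (n - b).
have -> : 2 * half_odd_count n = \sum_(1 <= b < n) h b.
  rewrite mul2n -addnn big_split; congr (_ + _); rewrite /half_odd_count big_nat_rev.
  by apply: eq_bigr => b _; rewrite add1n subSS.
have -> : 2 * half_gcd_sum n = \sum_(1 <= b < n) gcdn n b * h b.
  under [RHS]eq_bigr do rewrite mulnDr.
  rewrite mul2n -addnn big_split; congr (_ + _).
    by apply: eq_bigr => b _; rewrite mulnC.
  rewrite /half_gcd_sum big_nat_rev; apply: eq_big_nat => b b_lt.
  by rewrite add1n subSS gcdn_subr 1?mulnC//; lia.
rewrite pairs_countE big_distrr -!big_split /=; apply: eq_big_nat => b b_lt.
have g_odd : odd (gcdn n b) by apply: dvdn_odd n_odd; rewrite dvdn_gcdl.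
rewrite (eq_big_nat _ _ (F2 := fun j => odd j + ~~ odd j * h b)); last first.
  by move=> j /andP[j_gt0 _]; rewrite gcd_term_odd.
rewrite sum_parity; move: (gcdn n b) (h b) g_odd => g k g_odd.
have := odd_double_half g; rewrite g_odd uphalf_half g_odd; nia.
Qed.

(** * Counting edge numbers *)

(** The arithmetic conditions for an extremal graph with [x] independent vertices of
degree [s] and [y] vertices of degree [t]. *)
Definition semiregular_cond (x s y t : nat) : bool :=
  [&& (y %| x * s)%N, s <= y & t - (x * s %/ y)%N < y].

(** The independent class consists of the vertices of degree [q] or of those of
degree [q + 1], whichever have the smaller total degree; in case of a tie only
the first choice is tested, so that each edge number is counted once. *)
Definition quot_cond (n q b : nat) : bool :=
  if (n - b) * q <= b * q.+1 then semiregular_cond (n - b) q b q.+1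
  else semiregular_cond b q.+1 (n - b) q.

Definition good_edge (n e : nat) : bool :=
  (0 < (2 * e) %% n) && quot_cond n (2 * e %/ n)%N ((2 * e) %% n).

Definition low_cond (n q b : nat) : bool :=
  ((n - b) * q <= b * q.+1) && semiregular_cond (n - b) q b q.+1.

Definition high_cond (n q a : nat) : bool :=
  ((n - a) * q.+1 < a * q) && semiregular_cond (n - a) q.+1 a q.

Lemma quot_condE n q b : b <= n ->
  quot_cond n q b = low_cond n q b + high_cond n q (n - b) :> nat.
Proof.
move=> b_le; rewrite /quot_cond /low_cond /high_cond subKn// [b * _ < _]ltnNge.
by case: ifP => _; rewrite ?addn0.
Qed.

Lemma good_edge_lt n e (n_gt0 : 0 < n) : good_edge n e -> e < n * n.
Proof.
rewrite /good_edge; case: n n_gt0 => // n _.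
have eE := divn_eq (2 * e) n.+1; have := ltn_pmod (2 * e) (ltn0Sn n).
move: (_ %/ _)%N (_ %% _) eE => q b eE b_lt /andP[b_gt0].
have q_le : (q <= n) -> e < n.+1 * n.+1.
  by move=> qn; have := leq_mul qn (leqnn n.+1); rewrite [n.+1 * n.+1]mulSn; lia.
by rewrite /quot_cond /semiregular_cond; case: ifP => _ /and3P[_ h _]; apply: q_le; lia.
Qed.

Lemma good_edge_count n : 0 < n ->
  \sum_(0 <= e < n * n) good_edge n e =
  \sum_(1 <= b < n) \sum_(0 <= q < 2 * n) ~~ odd (q * n + b) * quot_cond n q b.
Proof.
move=> n_gt0; pose F u := (0 < u %% n) && quot_cond n (u %/ n)%N (u %% n).
(* Only the even [u = 2 * e] count; then write [u = q * n + b]. *)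
transitivity (\sum_(0 <= u < n * n * 2) ~~ odd u * F u).
  rewrite [RHS]sum_blocks; apply: eq_bigr => e _; rewrite big_ltn// big_nat1.
  by rewrite addn0 oddD oddM andbF mul0n addn0 mul1n (mulnC e).
rewrite (mulnC _ 2) mulnA sum_blocks exchange_big /= [LHS]big_ltn//.
rewrite [X in X + _]big1 ?add0n => [|q _]; last by rewrite /F addn0 modnMl muln0.
apply: eq_big_nat => b /andP[b_gt0 b_lt]; apply: eq_bigr => q _; congr (_ * nat_of_bool _).
by rewrite /F modnMDl modn_small// b_gt0 divnMDl// divn_small// addn0.
Qed.

Lemma low_cond_zero n b : 0 < b -> ~~ odd b * low_cond n 0 b = ~~ odd b.
Proof.
move=> b_gt0; case: (boolP (odd b)) => // b_even.
rewrite /low_cond /semiregular_cond !muln0 div0n dvdn0 /= subn0.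
by case: b b_gt0 b_even => [|[]].
Qed.

(** For [1 <= q <= b] divisibility and the inequality imply the remaining conditions,
except for [q = b = n - 1]: the single vertex of degree [n - 1] would leave the
others with one internal neighbour too many.  The parity condition holds there
exactly when [n] is odd. *)
Lemma low_condE n q b : 0 < q <= b -> b < n ->
  ~~ odd (q * n + b) * low_cond n q b + [&& q == b, b == n.-1 & odd n] =
  (b %| n * q)%N * (~~ odd (q * n + b) * (n * q <= b * (2 * q + 1))).
Proof.
move=> q_bd b_lt; rewrite /low_cond /semiregular_cond.
have -> : ((n - b) * q <= b * q.+1) = (n * q <= b * (2 * q + 1)).
  by rewrite mulnBl leq_subLR; congr (_ <= _); lia.
have dvdE : (b %| (n - b) * q)%N = (b %| n * q)%N.
  by rewrite -[in RHS](subnK (ltnW b_lt)) mulnDl dvdn_addl// dvdn_mulr.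
rewrite dvdE; case: (boolP (b %| n * q)%N) => bq /=; last first.
  rewrite andbF muln0; case: eqP => // qb; by rewrite qb dvdn_mull in bq.
have k_gt0 : 0 < ((n - b) * q %/ b)%N.
  rewrite divn_gt0; last by case/andP: q_bd; exact: leq_trans.
  apply: dvdn_leq; last by rewrite dvdE.
  by rewrite muln_gt0 subn_gt0 b_lt; case/andP: q_bd.
have [qb|qb] := eqVneq q b; last first.
  rewrite addn0 mul1n (_ : (q <= b) && _ = true) ?andbT//.
  by move: (_ %/ _)%N k_gt0 => k k_gt0; lia.
rewrite qb mulnK in k_gt0 *; last by lia.
rewrite leqnn /= mul1n.
have [bn|bn] := eqVneq b n.-1; last first.
  by rewrite addn0 (_ : (_ < b) = true) ?andbT//; move/eqP: bn; lia.
have -> : (b.+1 - (n - b) < b) = false by lia.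
have -> : (n * b <= b * (2 * b + 1)) by rewrite mulnC leq_mul2l; lia.
rewrite andbF muln0 add0n muln1 oddD oddM bn; case: n b_lt {dvdE bq k_gt0 bn} => //= n.
by case: (odd n).
Qed.

(** The variable [p] stands for the larger degree [q + 1]. *)
Lemma high_condE n p a : 0 < p <= a -> a < n ->
  ~~ odd (p.-1 * n + (n - a)) * high_cond n p.-1 a =
  (a %| n * p)%N * (~~ odd (p * n + a) * (n * p + a < 2 * (a * p))).
Proof.
case: p => // p /= p_lt a_lt; rewrite /high_cond /semiregular_cond p_lt /=.
have -> : odd (p * n + (n - a)) = odd (p.+1 * n + a).
  by rewrite mulSn !oddD oddB ?(ltnW a_lt)// addbCA addbA.
have -> : (a %| (n - a) * p.+1)%N = (a %| n * p.+1)%N.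
  by rewrite -[in RHS](subnK (ltnW a_lt)) mulnDl dvdn_addl// dvdn_mulr.
have -> : (p - ((n - a) * p.+1 %/ a)%N < a) = true by rewrite (leq_ltn_trans (leq_subr _ _)).
have -> : ((n - a) * p.+1 < a * p) = (n * p.+1 + a < 2 * (a * p.+1)).
  have : a * p.+1 <= n * p.+1 by rewrite leq_mul2r ltnW.
  by rewrite mulnBl mulnS; move: (n * _) (a * p) => u v; lia.
by rewrite andbT mulnCA; case: (_ %| _)%N; rewrite ?andbT ?mul1n ?andbF ?muln0.
Qed.

Lemma low_cond_sum n b : 0 < b < n ->
  \sum_(0 <= q < 2 * n) ~~ odd (q * n + b) * low_cond n q b + ((b == n.-1) && odd n) =
  ~~ odd b + \sum_(1 <= q < b.+1)
    (b %| n * q)%N * (~~ odd (q * n + b) * (n * q <= b * (2 * q + 1))).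
Proof.
move=> /andP[b_gt0 b_lt]; rewrite big_ltn; last by lia.
rewrite add0n low_cond_zero// -addnA; congr (_ + _).
rewrite (@big_cat_nat _ _ _ b.+1) //=; last by lia.
rewrite [X in _ + X + _](_ : _ = 0) ?addn0; last first.
  rewrite big_nat big1// => q q_gt; rewrite /low_cond /semiregular_cond.
  by rewrite (_ : (q <= b) = false) ?andbF ?muln0//; lia.
have -> : ((b == n.-1) && odd n) = \sum_(1 <= q < b.+1) [&& q == b, b == n.-1 & odd n] :> nat.
  rewrite big_nat_recr//= eqxx [X in X + _](_ : _ = 0)// big_nat big1// => q q_lt.
  by rewrite (_ : (q == b) = false)//; lia.
rewrite -big_split; apply: eq_big_nat => q q_bd /=; exact: low_condE.
Qed.

Lemma high_cond_sum n a : 0 < a < n ->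
  \sum_(0 <= q < 2 * n) ~~ odd (q * n + (n - a)) * high_cond n q a =
  \sum_(1 <= p < a.+1)
    (a %| n * p)%N * (~~ odd (p * n + a) * (n * p + a < 2 * (a * p))).
Proof.
move=> /andP[a_gt0 a_lt]; rewrite (@big_cat_nat _ _ _ a) //=; last by lia.
rewrite [X in _ + X](_ : _ = 0) ?addn0; last first.
  rewrite big_nat big1// => q q_ge; rewrite /high_cond /semiregular_cond.
  by rewrite (_ : (q < a) = false) ?andbF ?muln0//; lia.
by rewrite [RHS]big_add1 /=; apply: eq_big_nat => q q_lt; rewrite -high_condE.
Qed.

(** The sum over even [b] counts the pairs with [q = 0], that is, the matchings.  The
correction [odd n] is the exceptional pair [q = b = n - 1]. *)
Lemma good_edge_pairs n : 1 < n ->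
  \sum_(0 <= e < n * n) good_edge n e + odd n =
  \sum_(1 <= b < n) ~~ odd b + pairs_count n.
Proof.
move=> n_gt1; rewrite good_edge_count; last by lia.
transitivity (\sum_(1 <= b < n) \sum_(0 <= q < 2 * n) ~~ odd (q * n + b) * low_cond n q b
  + \sum_(1 <= b < n) \sum_(0 <= q < 2 * n) ~~ odd (q * n + (n - b)) * high_cond n q b
  + \sum_(1 <= b < n) ((b == n.-1) && odd n)).
  congr (_ + _).
    rewrite [X in _ = _ + X]big_nat_rev -big_split; apply: eq_big_nat => b b_lt.
    rewrite -big_split; apply: eq_bigr => q _ /=.
    by rewrite quot_condE ?mulnDr ?add1n ?subSS ?subKn//; lia.
  case: n n_gt1 => [|[|n]]// _; rewrite big_nat_recr//= eqxx [X in X + _](_ : _ = 0)//.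
  by rewrite big_nat big1// => b b_lt; rewrite (_ : (b == n.+1) = false)//; lia.
rewrite addnAC -!big_split /=; apply: eq_big_nat => b b_lt.
rewrite low_cond_sum// high_cond_sum// -addnA -big_split; congr (_ + _).
by apply: eq_bigr => q _ /=; rewrite -!mulnDr.
Qed.

(** The even [b] are the [2 * j], and [gcdn (2 * m) (2 * j) = 2 * gcdn m j]. *)
Lemma even_good_edge_count m : 0 < m ->
  \sum_(0 <= e < m.*2 * m.*2) good_edge m.*2 e + m + 1 = 2 * pillai m.
Proof.
move=> m_gt0; have n_even : ~~ odd m.*2 by rewrite odd_double.
have := @good_edge_pairs m.*2; rewrite (negPf n_even) addn0 => ->; last by lia.
rewrite pairs_count_even// -big_split /=.
pose F b := 1 + gcdn m.*2 b.
have <- : \sum_(1 <= b < m.*2) ~~ odd b * F b =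
    \sum_(1 <= b < m.*2) (~~ odd b + ~~ odd b * gcdn m.*2 b).
  by apply: eq_bigr => b _; rewrite mulnDr muln1.
have : \sum_(1 <= b < (m * 2).+1) (2 %| b)%N * F b = m + 2 * pillai m.
  rewrite sum_multiples// big_split /= sum_nat_const_nat subn1 muln1 /pillai big_distrr /=.
  by congr (_ + _); apply: eq_bigr => j _; rewrite -mul2n (mulnC j) -muln_gcdr gcdnC.
rewrite muln2 big_nat_recr /=; last by lia.
rewrite dvdn2 n_even mul1n [X in _ + X]/F gcdnn.
under eq_bigr => b _ do rewrite dvdn2.
lia.
Qed.

Lemma odd_good_edge_count n : 1 < n -> odd n ->
  2 * (\sum_(0 <= e < n * n) good_edge n e) + 4 + 2 * half_odd_count n =
  n + pillai n + 2 * half_gcd_sum n.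
Proof.
move=> n_gt1 n_odd; have := good_edge_pairs n_gt1; have := pairs_count_odd n_odd.
have -> : \sum_(1 <= b < n) (gcdn n b + 1) = pillai n - n + (n - 1).
  rewrite big_split /= sum_nat_const_nat muln1 /pillai big_nat_recr//=; last by lia.
  by rewrite gcdnn addnK.
have : n <= pillai n.
  by rewrite /pillai big_nat_recr//= ?gcdnn ?leq_addl//; lia.
have : 2 * \sum_(1 <= b < n) ~~ odd b = n - 1.
  have := @sum_odd n.-1; rewrite prednK; last by lia.
  have : \sum_(1 <= b < n) odd b + \sum_(1 <= b < n) ~~ odd b = n - 1.
    rewrite -big_split -[RHS]muln1 -sum_nat_const_nat; apply: eq_bigr => b _ /=.
    by case: (odd b).
  lia.
rewrite n_odd; lia.
Qed.

Lemma good_edgesE (R : realType) n : 0 < n ->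
  good_edges R n = [set e | good_edge n e]%classic.
Proof.
move=> n_gt0; suff E e : ~~ (n %| 2 * e) /\ rho_eq R n e <-> good_edge n e.
  by apply/seteqP; split=> e /E.
rewrite /good_edge /dvdn -lt0n; set b := (2 * e) %% n; set q := (2 * e %/ n)%N.
have b_lt : b < n by rewrite ltn_pmod.
have eE : 2 * e = q * n + b by exact: divn_eq.
have [b_gt0|_] /= := ltnP 0 b; last by split=> [[]|].
suff -> : rho_eq R n e <-> quot_cond n q b by split=> [[]|].
have nE : (n - b) + b = n by rewrite subnK// ltnW.
rewrite /quot_cond; case: leqP => cmp.
  rewrite -{1}nE; apply: rho_eq_iff => //.
  - by rewrite subn_gt0.
  - by rewrite muln_gt0 b_gt0.
  - by left.
  by rewrite eE mulnS -{2}nE; ring.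
have q_gt0 : 0 < q by case: (q) cmp => //; rewrite muln0.
rewrite -{1}nE addnC; apply: rho_eq_iff => //.
- by rewrite muln_gt0 subn_gt0 b_lt.
- exact: ltnW.
- by right.
by rewrite eE mulnS -{2}nE; ring.
Qed.

Local Open Scope ring_scope.

Theorem theorem7p1 (R : realType) (n : nat) (hn : (3 <= n)%N) :
  finite_set (good_edges R n) /\
  (#|` fset_set (good_edges R n)|%fset)%:R =
    (if odd n
     then 3 / 4 * (pillai n)%:R + (n%:R - (chi4_totient n)%:~R - 8 + (chi4 n)%:~R) / 4
     else 2 * (pillai n./2)%:R - (n./2)%:R - 1) :> rat.
Proof.
have n_gt0 : (0 < n)%N by lia.
pose s := [seq e <- iota 0 (n * n) | good_edge n e].
have sE : good_edges R n = [set` [fset e in s]%fset]%classic.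
  rewrite good_edgesE//; apply/seteqP; split=> e /=.
    by rewrite inE mem_filter mem_iota => eP; rewrite eP (good_edge_lt n_gt0 eP).
  by rewrite inE mem_filter => /andP[].
split; first by rewrite sE; exact: finite_fset.
have -> : #|` fset_set (good_edges R n)|%fset = (\sum_(0 <= e < n * n) good_edge n e)%N.
  rewrite sE set_fsetK card_fseq undup_id ?filter_uniq ?iota_uniq//.
  rewrite size_filter -sum1_count big_mkcond /index_iota subn0.
  by apply: eq_bigr => e _; case: good_edge.
case: ifPn => [n_odd|n_even].
  have := odd_good_edge_count (ltnW hn) n_odd.
  have := half_gcd_sumE n_odd; have := half_odd_countE n_odd.
  move: (\sum_(_ <= _ < _) _)%N (half_odd_count n) (half_gcd_sum n) => E N S NE SE EE.
  have {NE SE EE} : 4 * E%:Z = 3 * (pillai n)%:Z + n%:Z - chi4_totient n - 8 + chi4 n.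
    by lia.
  move/(congr1 (intr : int -> rat)).
  rewrite !(rmorphD, rmorphN, rmorphM, rmorph1) /= -!pmulrn => EE.
  by lra.
have m_gt0 : (0 < n./2)%N by lia.
have := even_good_edge_count m_gt0; rewrite even_halfK// => EE.
have /(congr1 (fun k : nat => k%:R : rat)) := EE.
by rewrite /= natrM !natrD => {}EE; lra.
Qed.
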